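(* Let $\Gamma=A_L$ be the right-angled Artin group defined by a finite flag complex $L$, let $H$ be a finite index subgroup of $\Gamma$, and let $F$ be any field. Then for every integer $i\ge 0$, $$b_i^{(2)}(H;F)=[\Gamma:H]\,b_i^{(2)}(\Gamma;F),$$ where the two sides are computed with respect to arbitrary residual chains in $H$ and in $\Gamma$, respectively.
   Context: A flag complex is a simplicial complex in which every finite set of pairwise adjacent vertices spans a simplex. For a flag complex $L$ with vertex set $V$, the right-angled Artin group $A_L$ has generators $\{g_v\}_{v\in V}$ and relations $[g_v,g_{v'}]=1$ whenever $\{v,v'\}$ is an edge of $L$. A residual chain in a group $G$ is a nested decreasing sequence $(G_k)_k$ of finite index normal subgroups of $G$ with $\bigcap_k G_k=1$. For a group $G$ with a finite classifying space and a residual chain $(G_k)_k$ in $G$, define $$b_i^{(2)}(G;F):=\limsup_k\frac{b_i(BG_k;F)}{[G:G_k]},$$ where $BG_k$ is a classifying space of $G_k$ and $b_i(X;F)=\dim_F H_i(X;F)$. (The chain in $H$ is required to be normal in $H$, not necessarily in $\Gamma$.) *)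

(* Defs.v *)
From HB Require Import structures.
From mathcomp Require Import all_boot all_order all_algebra generic_quotient finmap.
From mathcomp Require Import zify.
From mathcomp Require Import all_classical all_reals all_analysis.
(* The notations of monalg clash with those of MathComp-Analysis. *)
From mathcomp Require Import -(notations) monalg.

Set Implicit Arguments.
Unset Strict Implicit.
Unset Printing Implicit Defensive.

Import Order.TTheory GRing.Theory Num.Theory.
Local Open Scope quotient_scope.
Local Open Scope classical_set_scope.
Local Open Scope ring_scope.

Record simplicial_complex (V : finType) := SimplicialComplex {
  simplices :> {set {set V}};
  simplex_neq0 : finset.set0 \notin simplices;
  simplex_vertex : forall v : V, [set v]%SET \in simplices;
  simplex_face : forall s t : {set V},
    s \in simplices -> t != finset.set0 -> t \subset s -> t \in simplices
}.

Definition adjacent (V : finType) (L : simplicial_complex V) (u v : V) :=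
  (u != v) && ([set u; v]%SET \in simplices L).

Definition is_flag (V : finType) (L : simplicial_complex V) : Prop :=
  forall s : {set V}, s != finset.set0 ->
    {in s &, forall u v, u != v -> adjacent L u v} -> s \in simplices L.

(* The letter [(v, false)] stands for v, and [(v, true)] for its inverse. *)
Definition word (V : choiceType) := seq (V * bool).

Definition inv_word (V : choiceType) (w : word V) : word V :=
  rev [seq (a.1, ~~ a.2) | a <- w].

Section PresentedGroup.
Variables (V : choiceType) (rels : set (word V)).

Inductive word_eq : word V -> word V -> Prop :=
| word_eq_refl w : word_eq w w
| word_eq_sym w1 w2 : word_eq w1 w2 -> word_eq w2 w1
| word_eq_trans w1 w2 w3 : word_eq w1 w2 -> word_eq w2 w3 -> word_eq w1 w3
| word_eq_cancel w1 w2 v b :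
    word_eq (w1 ++ [:: (v, b); (v, ~~ b)] ++ w2) (w1 ++ w2)
| word_eq_rel w1 w2 r : rels r -> word_eq (w1 ++ r ++ w2) (w1 ++ w2).

Definition word_eqb (w1 w2 : word V) : bool := `[< word_eq w1 w2 >].

Lemma word_eqb_equiv : equiv_class_of word_eqb.
Proof.
split.
- by move=> w; apply/asboolP; exact: word_eq_refl.
- by move=> w1 w2; apply/asboolP/asboolP; exact: word_eq_sym.
- move=> w2 w1 w3 /asboolP h1 /asboolP h2; apply/asboolP.
  exact: word_eq_trans h1 h2.
Qed.

Canonical word_eqb_equiv_rel := EquivRelPack word_eqb_equiv.

Definition presented_group := {eq_quot word_eqb_equiv_rel}.

HB.instance Definition _ := Choice.on presented_group.
HB.instance Definition _ := EqQuotient.on presented_group.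

Implicit Types (w : word V) (x y z : presented_group).

Lemma pi_wordP w1 w2 :
  \pi_presented_group w1 = \pi_presented_group w2 <-> word_eq w1 w2.
Proof. by split=> [/eqmodP/asboolP //|h]; apply/eqmodP/asboolP. Qed.

Lemma word_eq_cat w1 w1' w2 w2' :
  word_eq w1 w1' -> word_eq w2 w2' -> word_eq (w1 ++ w2) (w1' ++ w2').
Proof.
move=> h1 h2; apply: (@word_eq_trans _ (w1' ++ w2)).
- elim: h1 w2 {h2} => [w|? ? _ IH|? ? ? _ IH1 _ IH2|u u' v b|u u' r hr] w2.
  + exact: word_eq_refl.
  + exact: word_eq_sym.
  + exact: word_eq_trans (IH1 _) (IH2 _).
  + by rewrite -!catA; exact: word_eq_cancel.
  + by rewrite -!catA; exact: word_eq_rel.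
- elim: h2 w1' {h1} => [w|? ? _ IH|? ? ? _ IH1 _ IH2|u u' v b|u u' r hr] w1'.
  + exact: word_eq_refl.
  + exact: word_eq_sym.
  + exact: word_eq_trans (IH1 _) (IH2 _).
  + by rewrite !(catA w1'); exact: word_eq_cancel.
  + by rewrite !(catA w1'); exact: word_eq_rel.
Qed.

Lemma word_eq_invr w : word_eq (w ++ inv_word w) [::].
Proof.
elim: w => [|[v b] w IH]; first exact: word_eq_refl.
rewrite /inv_word /= rev_cons -/(inv_word w) -cats1 catA.
apply: (word_eq_trans (w2 := [:: (v, b)] ++ [::] ++ [:: (v, ~~ b)])).
  rewrite (_ : _ :: _ = [:: (v, b)] ++ (w ++ inv_word w) ++ [:: (v, ~~ b)]) //.
  apply: word_eq_cat; first exact: word_eq_refl.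
  by apply: word_eq_cat => //; exact: word_eq_refl.
exact: (word_eq_cancel [::] [::]).
Qed.

Lemma inv_wordK : involutive (@inv_word V).
Proof.
move=> w; rewrite /inv_word map_rev revK -map_comp map_id_in //.
by move=> [v b] _ /=; rewrite negbK.
Qed.

Lemma word_eq_invl w : word_eq (inv_word w ++ w) [::].
Proof. by have := word_eq_invr (inv_word w); rewrite inv_wordK. Qed.

Definition pres_one : presented_group := \pi_presented_group [::].
Definition pres_mul x y : presented_group := \pi_presented_group (repr x ++ repr y).
Definition pres_inv x : presented_group := \pi_presented_group (inv_word (repr x)).

Lemma word_eq_repr w : word_eq (repr (\pi_presented_group w)) w.
Proof. by apply/pi_wordP; rewrite reprK. Qed.

Lemma pres_mulE w1 w2 :
  pres_mul (\pi_presented_group w1) (\pi_presented_group w2) =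
  \pi_presented_group (w1 ++ w2).
Proof. by apply/pi_wordP/word_eq_cat; exact: word_eq_repr. Qed.

Lemma pres_mulA : associative pres_mul.
Proof.
elim/quotW=> w1; elim/quotW=> w2; elim/quotW=> w3.
by rewrite (pres_mulE w2) (pres_mulE w1 w2) !pres_mulE catA.
Qed.

Lemma pres_mul1 : left_id pres_one pres_mul.
Proof. by elim/quotW=> w; rewrite /pres_one pres_mulE. Qed.

Lemma pres_mulr1 : right_id pres_one pres_mul.
Proof. by elim/quotW=> w; rewrite /pres_one pres_mulE cats0. Qed.

Lemma pres_mulV : left_inverse pres_one pres_inv pres_mul.
Proof.
elim/quotW=> w; rewrite /pres_inv pres_mulE.
apply/pi_wordP.
apply: word_eq_trans (word_eq_invl (repr (\pi_presented_group w))).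
apply: word_eq_cat; first exact: word_eq_refl.
by apply: word_eq_sym; exact: word_eq_repr.
Qed.

Lemma pres_mulrV : right_inverse pres_one pres_inv pres_mul.
Proof.
elim/quotW=> w; rewrite /pres_inv pres_mulE.
apply/pi_wordP.
apply: word_eq_trans (word_eq_invr (repr (\pi_presented_group w))).
apply: word_eq_cat; last exact: word_eq_refl.
by apply: word_eq_sym; exact: word_eq_repr.
Qed.

HB.instance Definition _ := isGroup.Build presented_group
  pres_mulA pres_mul1 pres_mulr1 pres_mulV pres_mulrV.

End PresentedGroup.

Definition raag_relators (V : finType) (L : simplicial_complex V) :
    set (word V) :=
  [set r | exists u v, adjacent L u v /\
     r = [:: (u, true); (v, true); (u, false); (v, false)]].

Definition raag (V : finType) (L : simplicial_complex V) : groupType :=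
  presented_group (raag_relators L).

(* A subgroup is a [groupClosed] predicate; since the logic is classical, this *)
(* loses no generality over [set G].                                           *)
Section SubgroupType.
Variables (G : groupType) (H : groupClosed G).

Definition subgroup_type := {x : G | x \in H}.

HB.instance Definition _ := SubChoice.on subgroup_type.

Lemma subgroup_type_closed : group_closed [pred x : G | x \in H].
Proof.
by split=> [|x y xH yH]; [exact: gpred1 | exact: gpredF].
Qed.

HB.instance Definition _ :=
  SubChoice_isSubGroup.Build G _ subgroup_type subgroup_type_closed.

End SubgroupType.

Section Index.
Variables (G : groupType) (H : groupClosed G).

Definition left_cosets : set (set G) :=
  range (fun x : G => [set y | (x^-1 * y)%g \in H]).

Definition finite_index : Prop := finite_set left_cosets.

(* [G : H], meaningful under [finite_index]; [fset_set] is empty otherwise. *)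
Definition subgroup_index : nat := #|` fset_set left_cosets |%fset.

Definition is_normal : Prop := forall x y : G, x \in H -> (x ^ y)%g \in H.

End Index.

Definition residual_chain (G : groupType) (K : nat -> groupClosed G) : Prop :=
  [/\ forall k, {subset K k.+1 <= K k},
      forall k, is_normal (K k),
      forall k, finite_index (K k) &
      forall x : G, (forall k, x \in K k) -> x = 1%g].

(* [face n i] is relevant only for i <= n + 1. *)
Record semisimplicial_set := SemisimplicialSet {
  cells :> nat -> choiceType;
  face : forall n, nat -> cells n.+1 -> cells n;
  faceC : forall n i j (x : cells n.+2), (i < j <= n.+2)%N ->
    face i (face j x) = face j.-1 (face i x)
}.

Section Homology.
Variables (R : realType) (F : fieldType) (X : semisimplicial_set).

(* The vector space with basis [X n]. *)
Definition chains (n : nat) : lmodType F := malg (X n) F.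

Definition boundary n (c : chains n.+1) : chains n :=
  \sum_(x <- msupp c) mcoeff x c *:
    \sum_(i < n.+2) (-1) ^+ i *: (mkmalgU (face i x) 1 : chains n).

Definition cycles (n : nat) : set (chains n) :=
  match n with
  | 0 => setT
  | m.+1 => [set c : chains m.+1 | boundary c = 0]
  end.

Definition boundaries (n : nat) : set (chains n) := range (@boundary n).

(* The dimension of the quotient Z / B of F-vector spaces: the supremum of the *)
(* sizes of the finite families in Z whose classes are linearly independent.   *)
Definition quotient_dim (C : lmodType F) (Z B : set C) : \bar R :=
  ereal_sup [set n%:R%:E | n in [set n : nat |
    exists2 e : 'I_n -> C, (forall j, Z (e j)) &
      forall a : 'I_n -> F, B (\sum_(j < n) a j *: e j) -> forall j, a j = 0]].

(* b_n(X; F) = dim_F H_n(X; F). *)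
Definition betti (n : nat) : \bar R := quotient_dim (@cycles n) (@boundaries n).

End Homology.

(* The classifying space of a discrete group [G] is its nerve: an n-simplex is *)
(* an n-tuple (g_0, ..., g_(n-1)); the i-th face multiplies g_(i-1) and g_i,   *)
(* and drops the first, resp. last, entry for i = 0, resp. i = n.              *)
Section ClassifyingSpace.
Variable G : groupType.

Definition nerve_face n (i : nat) (g : {ffun 'I_n.+1 -> G}) :
    {ffun 'I_n -> G} :=
  [ffun j : 'I_n =>
     if (j.+1 < i)%N then g (inord j)
     else if j.+1 == i then (g (inord j) * g (inord j.+1))%g
     else g (inord j.+1)].

Lemma nerve_faceC n i j (g : {ffun 'I_n.+2 -> G}) : (i < j <= n.+2)%N ->
  nerve_face i (nerve_face j g) = nerve_face j.-1 (nerve_face i g).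
Proof.
case: j => [|j]; first by rewrite ltn0.
move=> /andP[]; rewrite !ltnS /= => ij jn; apply/ffunP => k; rewrite !ffunE.
have kn := ltn_ord k.
have e1 : inord (n' := n) k = k :> nat by rewrite inordK// ltnW.
have e2 : inord (n' := n) k.+1 = k.+1 :> nat by rewrite inordK.
rewrite !e1 !e2 !eqSS !ltnS.
by case: (ltngtP k.+1 i) => h1; case: (ltngtP k.+1 j) => h2;
  case: (ltngtP k.+2 i) => h3; case: (ltngtP k j) => h4;
  rewrite ?mulgA //; exfalso; lia.
Qed.

Definition BG : semisimplicial_set :=
  SemisimplicialSet (cells := fun n => {ffun 'I_n -> G}) nerve_faceC.

End ClassifyingSpace.

(* b_i^(2)(G; F) computed along the chain [K]. *)
Definition l2betti (R : realType) (F : fieldType) (G : groupType)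
    (K : nat -> groupClosed G) (i : nat) : \bar R :=
  limn_esup (fun k =>
    betti R F (BG (subgroup_type (K k))) i * ((subgroup_index (K k))%:R^-1)%:E)%E.

(* Main.v *)
(** Let C_n be the free F[Gamma]-module on the n-cliques of L, with the Koszul
differential of the commuting operators g_v - 1. This Salvetti complex is a
free resolution of F: adding vertices one at a time presents it as an iterated
mapping cone, and the only injectivity needed is a retraction given by a Fox
derivative. For a finite index subgroup K of Gamma, comparison with the bar
resolution shows that the homology of BK is that of the Koszul complex of the
operators g_v - 1 on F[K\Gamma]. If these operators were invertible, taking
their products over cliques would identify it with [Gamma:K] copies of the
augmented chain complex of L. The kernel of g_v - 1 has as dimension the number
of orbits of g_v on K\Gamma, and along a chain that is residual and normal in
some fixed finite index subgroup the orbits of g_v get arbitrarily long. So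
b_n(K) / [Gamma:K] converges to the reduced Betti number of L in degree n - 1,
whatever the chain; both sides of the theorem follow, since
[Gamma:K] = [Gamma:H] [H:K]. *)

From HB Require Import structures.
From mathcomp Require Import all_boot all_order all_algebra.
From mathcomp Require Import generic_quotient finmap.
From mathcomp Require Import zify ring lra.
From mathcomp Require Import all_classical all_reals all_analysis.
From mathcomp Require Import -(notations) monalg.
From mathcomp Require Import fintype finset.
Require Import Defs.

Set Implicit Arguments.
Unset Strict Implicit.
Unset Printing Implicit Defensive.

Import Order.TTheory GRing.Theory Num.Theory.

(** * Right-angled Artin groups *)

(** Lück's approximation theorem belongs to characteristic zero; over an arbitrary field the limsup
    could a priori depend on the chain. So each b_n(K) is estimated directly, with an error
    controlled by the kernels of g_v - 1. If two differentials are intertwined by maps between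
    spaces of equal dimension whose kernels have dimension at most d, their ranks differ by at most
    d. With N = [Gamma:K], the kernel of g_v - 1 has dimension at most N/m once all orbits of g_v
    have at least m points, so the error is at most C N/m, with C depending only on L and n.

    A chain in H need not be normal in Gamma, so K\Gamma is only a set with a right action. A coset
    fixed by g_v^j puts a conjugate of g_v^j into K; normality in H leaves only conjugates by
    representatives of H\Gamma. For j < m these are finitely many nontrivial elements, and the chain
    eventually avoids them.

    For exactness, adding v gives the cone of g_v - 1 from the complex of the link to the complex
    without v. By induction both have homology only in degree 0, so injectivity matters there
    alone. *)

Section RaagGroup.
Variables (V : finType) (L : simplicial_complex V).
Local Open Scope group_scope.
Local Open Scope quotient_scope.
Implicit Types (x y z : raag L) (u v : V) (w : word V).

Lemma adjacentC u v : adjacent L u v = adjacent L v u.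
Proof. by rewrite /adjacent eq_sym finset.setUC. Qed.

Definition word_class w : raag L := \pi_(presented_group (raag_relators L)) w.

Definition gen v : raag L := word_class [:: (v, false)].

Lemma word_class_cat w1 w2 :
  word_class (w1 ++ w2) = word_class w1 * word_class w2.
Proof. by rewrite /word_class -(pres_mulE _ w1 w2). Qed.

Lemma word_class_inv v : word_class [:: (v, true)] = (gen v)^-1.
Proof.
apply: (mulIg (gen v)); rewrite mulVg /gen -word_class_cat.
by apply/pi_wordP; exact: (word_eq_cancel _ [::] [::] v true).
Qed.

Lemma raag_ind (P : raag L -> Prop) :
  P 1 -> (forall x v, P x -> P (x * gen v)) ->
  (forall x v, P x -> P (x * (gen v)^-1)) -> forall x, P x.
Proof.
move=> P1 Pg PV; elim/quotW=> w; elim/last_ind: w => [|w [v []] IH] //.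
- have /= := word_class_cat w [:: (v, true)]; rewrite cats1 /word_class => ->.
  by rewrite -!/(word_class _) word_class_inv; apply: PV.
- have /= := word_class_cat w [:: (v, false)]; rewrite cats1 /word_class => ->.
  exact: Pg.
Qed.

Lemma gen_commute u v : adjacent L u v -> gen u * gen v = gen v * gen u.
Proof.
move=> uv; apply: (mulgI ((gen v)^-1)); apply: (mulgI ((gen u)^-1)).
rewrite [in RHS]mulKg mulVg -!word_class_inv /gen -!word_class_cat.
apply/pi_wordP.
apply: (word_eq_rel [::] [::]
  (r := [:: (u, true); (v, true); (u, false); (v, false)])).
by exists u, v.
Qed.

(** * Right actions of the group, built from permutations *)

Section Action.
Variables (Y : Type) (up dn : V -> Y -> Y).
Hypothesis upK : forall v, cancel (up v) (dn v).
Hypothesis dnK : forall v, cancel (dn v) (up v).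
Hypothesis upC : forall u v (y : Y),
  adjacent L u v -> up u (up v y) = up v (up u y).

Definition run w (y : Y) :=
  foldl (fun (y : Y) a => (if a.2 then dn else up) a.1 y) y w.

Lemma run_cat w1 w2 (y : Y) : run (w1 ++ w2) y = run w2 (run w1 y).
Proof. exact: foldl_cat. Qed.

Lemma run_word_eq w1 w2 (y : Y) :
  word_eq (raag_relators L) w1 w2 -> run w1 y = run w2 y.
Proof.
move=> h; elim: h y => {w1 w2} [//|w1 w2 _ IH y|w1 w2 w3 _ IH1 _ IH2 y
  |w1 w2 v b y|w1 w2 r [u [v [uv ->]]] y]; rewrite ?IH ?IH1 //.
- by rewrite !run_cat /=; case: b => /=; rewrite ?upK ?dnK.
- rewrite !run_cat /=; congr (run w2 _).
  by rewrite upC 1?adjacentC// dnK dnK.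
Qed.

(** The universal property of the presentation, for right actions. Exponent sums, retractions and
    Fox derivatives are all obtained by moving a base point of a suitable [Y]. *)
Definition ract x (y : Y) := run (repr x) y.

Lemma ract_class w (y : Y) : ract (word_class w) y = run w y.
Proof. by apply: run_word_eq; exact: word_eq_repr. Qed.

Lemma ract1 (y : Y) : ract 1 y = y.
Proof. by rewrite -[RHS]/(run [::] y) -ract_class. Qed.

Lemma ractM x1 x2 (y : Y) : ract (x1 * x2) y = ract x2 (ract x1 y).
Proof.
elim/quotW: x1 => w1; elim/quotW: x2 => w2.
by rewrite -!/(word_class _) -word_class_cat !ract_class run_cat.
Qed.

Lemma ract_gen v (y : Y) : ract (gen v) y = up v y.
Proof. by rewrite ract_class. Qed.

Lemma ract_genV v (y : Y) : ract (gen v)^-1 y = dn v y.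
Proof. by rewrite -word_class_inv ract_class. Qed.

End Action.

(** The exponent sum at v, a witness that g_v has infinite order; hence powers of g_v must leave any
    residual chain. *)
Definition gen_exp v x : int :=
  ract (fun u (n : int) => if u == v then (n + 1)%R else n)
       (fun u (n : int) => if u == v then (n - 1)%R else n) x 0%R.

Lemma gen_expX v n : gen_exp v (gen v ^+ n) = n%:Z%R.
Proof.
rewrite /gen_exp; set up := (X in ract X); set dn := (X in ract _ X).
have upK u : cancel (up u) (dn u).
  by move=> m; rewrite /up /dn; case: (u == v) => //=; rewrite addrK.
have dnK u : cancel (dn u) (up u).
  by move=> m; rewrite /up /dn; case: (u == v) => //=; rewrite subrK.
have upC (u w : V) (y : int) : adjacent L u w -> up u (up w y) = up w (up u y).
  by move=> _; rewrite /up; do 2!case: ifP.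
elim: n => [|n IH]; first by rewrite expg0 ract1.
by rewrite expgSr ractM// IH ract_gen// /up eqxx; lia.
Qed.

Lemma gen_order v n : (0 < n)%N -> gen v ^+ n <> 1.
Proof.
move=> n0 e; have := gen_expX v n; rewrite e -(expg0 (gen v)) gen_expX; lia.
Qed.

Section Retraction.
Implicit Types W U : {set V}.

Let up W v (y : raag L) := if v \in W then y * gen v else y.
Let dn W v (y : raag L) := if v \in W then y * (gen v)^-1 else y.

(* The retraction onto the standard subgroup generated by W, which kills the *)
(* other generators.                                                         *)
Definition retr W x : raag L := ract (up W) (dn W) x 1.

Let upK W v : cancel (up W v) (dn W v).
Proof. by move=> y; rewrite /up /dn; case: (v \in W) => //; rewrite mulgK. Qed.

Let dnK W v : cancel (dn W v) (up W v).
Proof. by move=> y; rewrite /up /dn; case: (v \in W) => //; rewrite mulgVK. Qed.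

Let upC W u v (y : raag L) : adjacent L u v ->
  up W u (up W v y) = up W v (up W u y).
Proof.
move=> uv; rewrite /up; case: (u \in W); case: (v \in W) => //.
by rewrite -!mulgA (gen_commute uv).
Qed.

Lemma retr1 W : retr W 1 = 1.
Proof. exact: (ract1 (upK W) (dnK W) (@upC W)). Qed.

Lemma retrMgen W x v :
  retr W (x * gen v) = if v \in W then retr W x * gen v else retr W x.
Proof. by rewrite /retr (ractM (upK W) (dnK W) (@upC W))
  (ract_gen (upK W) (dnK W) (@upC W)). Qed.

Lemma retrMgenV W x v :
  retr W (x * (gen v)^-1) = if v \in W then retr W x * (gen v)^-1 else retr W x.
Proof. by rewrite /retr (ractM (upK W) (dnK W) (@upC W))
  (ract_genV (upK W) (dnK W) (@upC W)). Qed.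

Lemma retrM W x y : retr W (x * y) = retr W x * retr W y.
Proof.
elim/raag_ind: y => [|y v IH|y v IH]; first by rewrite retr1 !mulg1.
- by rewrite mulgA !retrMgen IH; case: ifP => //; rewrite mulgA.
- by rewrite mulgA !retrMgenV IH; case: ifP => //; rewrite mulgA.
Qed.

Lemma retrV W x : retr W x^-1 = (retr W x)^-1.
Proof. by apply: (mulgI (retr W x)); rewrite -retrM !mulgV retr1. Qed.

Lemma retrT x : retr [set: V]%SET x = x.
Proof.
elim/raag_ind: x => [|x v IH|x v IH]; first exact: retr1.
- by rewrite retrMgen inE IH.
- by rewrite retrMgenV inE IH.
Qed.

Lemma retr_comp W U x : retr W (retr U x) = retr (W :&: U)%SET x.
Proof.
elim/raag_ind: x => [|x v IH|x v IH]; first by rewrite !retr1.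
- rewrite !retrMgen inE [LHS]fun_if retrMgen IH.
  by case: (v \in W); case: (v \in U).
- rewrite !retrMgenV inE [LHS]fun_if retrMgenV IH.
  by case: (v \in W); case: (v \in U).
Qed.

Lemma retr_id W x : retr W (retr W x) = retr W x.
Proof. by rewrite retr_comp finset.setIid. Qed.

(* A canonical representative of the coset of x modulo the standard subgroup *)
(* generated by W.                                                           *)
Definition crep W x : raag L := x * (retr W x)^-1.

Lemma crepMgen W x v : v \in W -> crep W (x * gen v) = crep W x.
Proof. by move=> vW; rewrite /crep retrMgen vW invgM mulgA mulgK. Qed.

Lemma crep_id W x : crep W (crep W x) = crep W x.
Proof.
by rewrite {1}/crep {2}/crep retrM retrV retr_id mulgV invg1 mulg1.
Qed.

Lemma crepT x : crep [set: V]%SET x = 1.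
Proof. by rewrite /crep retrT mulgV. Qed.

(** The fixed points of [retr W] are the standard subgroup of W, so both sides say that x and y lie
    in the same left coset of it. *)
Lemma crepP W x y : crep W x = crep W y <-> retr W (y^-1 * x) = y^-1 * x.
Proof.
rewrite retrM retrV /crep; split=> [e|e].
  apply: (mulIg (retr W x)^-1); rewrite -mulgA mulgV mulg1 -mulgA e.
  by rewrite mulgA mulVg mul1g.
apply: (mulgI y^-1); rewrite mulgA -e -!mulgA mulgV mulg1.
by rewrite mulKg.
Qed.

Lemma crepS W U x y : U \subset W -> crep U x = crep U y -> crep W x = crep W y.
Proof.
by move=> UW /crepP e; apply/crepP; rewrite -e retr_comp (finset.setIidPr UW).
Qed.

(** Two standard subgroups meet in the standard subgroup of the intersection, because their
    retractions compose to its retraction. *)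
Lemma crepI W U x y : crep W x = crep W y -> crep U x = crep U y ->
  crep (W :&: U)%SET x = crep (W :&: U)%SET y.
Proof.
by move=> /crepP e1 /crepP e2; apply/crepP; rewrite -retr_comp e2 e1.
Qed.

End Retraction.

Section FoxCount.
Variables (A : zmodType) (e : A) (v : V) (h : raag L).

Definition lk : {set V} := [set u | adjacent L v u].

Let up u (p : raag L * A) : raag L * A :=
  (p.1 * gen u,
   if (u == v) && (crep lk p.1 == crep lk h) then (p.2 + e)%R else p.2).

Let dn u (p : raag L * A) : raag L * A :=
  (p.1 * (gen u)^-1,
   if (u == v) && (crep lk (p.1 * (gen u)^-1) == crep lk h) then (p.2 - e)%R
   else p.2).

(* The component at the coset of h of the Fox derivative with respect to v, *)
(* a derivation with values in the span of the cosets of the link of v.     *)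
Definition fox x : A := (ract up dn x (1, 0%R)).2.

Lemma foxMgen x u :
  fox (x * gen u) =
  if (u == v) && (crep lk x == crep lk h) then (fox x + e)%R else fox x.
Proof.
have upK t : cancel (up t) (dn t).
  move=> [y a]; rewrite /up /dn /= mulgK; case: (_ && _) => //=.
  by rewrite addrK.
have dnK t : cancel (dn t) (up t).
  move=> [y a]; rewrite /up /dn /= mulgVK; case: (_ && _) => //=.
  by rewrite subrK.
(* The counter moves only at v, and a generator commuting with v lies in the link, so multiplying by
   it does not change the coset being tested. *)
have upC (t1 t2 : V) (y : raag L * A) :
    adjacent L t1 t2 -> up t1 (up t2 y) = up t2 (up t1 y).
  move=> t12; rewrite /up /= -!mulgA (gen_commute t12); congr pair.
  have [e1|] := eqVneq t1 v.
    have [e2|_] /= := eqVneq t2 v.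
      by move: t12; rewrite e1 e2 /adjacent eqxx.
    by rewrite crepMgen// inE -e1.
  move=> _ /=; have [e2|_] //= := eqVneq t2 v.
  by rewrite crepMgen// inE -e2 adjacentC.
have fstE y : (ract up dn y (1, 0%R)).1 = y.
  elim/raag_ind: y => [|y w IH|y w IH].
  - by rewrite ract1.
  - by rewrite ractM// ract_gen// /up /= IH.
  - by rewrite ractM// ract_genV// /dn /= IH.
by rewrite /fox ractM// ract_gen// /up fstE.
Qed.

End FoxCount.

End RaagGroup.

Local Open Scope ring_scope.

(** * Linear extension to free vector spaces *)

Section LinearExtension.
Variables (F : fieldType) (S : choiceType) (M : lmodType F).
Implicit Types (phi : S -> M) (c : malg S F) (s : S).

Definition bas s : malg S F := mkmalgU s 1.

Definition mext phi c : M := \sum_(x <- msupp c) mcoeff x c *: phi x.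

Lemma mextEw phi c (d : {fset S}) : (msupp c `<=` d)%fset ->
  mext phi c = \sum_(x <- d) mcoeff x c *: phi x.
Proof.
move=> cd; rewrite /mext (big_fset_incl _ cd)//= => x _ xc.
by rewrite mcoeff_outdom// scale0r.
Qed.

Lemma mext_is_linear phi : linear (mext phi).
Proof.
move=> a c1 c2; pose d := (msupp c1 `|` msupp c2)%fset.
rewrite (@mextEw _ c1 d) ?fsubsetUl// (@mextEw _ c2 d) ?fsubsetUr//.
rewrite (@mextEw _ _ d); last first.
  apply: (fsubset_trans (msuppD_le _ _)); apply: fsetUSS => //.
  exact: msuppZ_le.
rewrite scaler_sumr -big_split /=; apply: eq_bigr => x _.
by rewrite mcoeffD mcoeffZ scalerDl scalerA.
Qed.

HB.instance Definition _ phi :=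
  GRing.isLinear.Build F (malg S F) M _ (mext phi) (mext_is_linear phi).

Lemma mext_bas phi s : mext phi (bas s) = phi s.
Proof.
rewrite (@mextEw _ _ [fset s]%fset) ?msuppU_le//.
by rewrite big_seq_fset1 mcoeffUU scale1r.
Qed.

Lemma malg_decomp c : c = \sum_(x <- msupp c) mcoeff x c *: bas x.
Proof.
rewrite {1}[c]monalgE; apply: eq_bigr => x _.
apply/malgP => k; rewrite mcoeffZ !mcoeffU.
by rewrite mulr_natr.
Qed.

Lemma eq_malg_linear (f g : {linear malg S F -> M}) :
  (forall s, f (bas s) = g (bas s)) -> f =1 g.
Proof.
move=> fg c; rewrite [c]malg_decomp !linear_sum; apply: eq_bigr => x _.
by rewrite !linearZ fg.
Qed.

Lemma eq_mext phi psi : phi =1 psi -> mext phi =1 mext psi.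
Proof. by move=> e c; apply: eq_bigr => x _; rewrite e. Qed.

Lemma mext0 c : mext (fun=> 0) c = 0.
Proof. by apply: big1 => x _; rewrite scaler0. Qed.

End LinearExtension.
Arguments bas {F S} s.

(** * The Koszul complex of a family of commuting operators *)

Section Cliques.
Variables (V : finType) (L : simplicial_complex V).
Implicit Types (s t W U : {set V}) (u v w : V).

Definition clique s : bool :=
  [forall u in s, forall v in s, (u != v) ==> adjacent L u v].

Lemma cliqueP s :
  reflect {in s &, forall u v, u != v -> adjacent L u v} (clique s).
Proof.
apply: (iffP forall_inP) => h.
  by move=> u v us vs; move/forall_inP: (h u us) => /(_ v vs)/implyP.
by move=> u us; apply/forall_inP => v vs; apply/implyP; exact: h.
Qed.

Lemma cliqueS s t : s \subset t -> clique t -> clique s.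
Proof.
by move=> /subsetP st /cliqueP h; apply/cliqueP => u v /st us /st vs; exact: h.
Qed.

Lemma cliqueU1 v s : v \notin s ->
  clique (v |: s)%SET = clique s && (s \subset lk L v).
Proof.
move=> vs; apply/idP/andP => [h|[/cliqueP h /subsetP sv]].
  split; first by apply: cliqueS h; exact: subsetUr.
  apply/subsetP => u us; rewrite inE; move/cliqueP: h; apply.
  - exact: setU11.
  - by rewrite inE us orbT.
  - by apply: contraNneq vs => ->.
apply/cliqueP => u w /setU1P[->|us] /setU1P[->|ws].
- by rewrite eqxx.
- by move: (sv _ ws); rewrite inE.
- by move: (sv _ us); rewrite inE adjacentC.
- exact: h.
Qed.

Definition iclique n W s := [&& clique s, #|s| == n & s \subset W].

Lemma iclique_lk n v W s : v \in W -> v \notin s ->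
  iclique n.+1 W (v |: s)%SET = iclique n ((W :\ v) :&: lk L v)%SET s.
Proof.
move=> vW vs; rewrite /iclique cliqueU1// cardsU1 vs add1n eqSS.
rewrite subUset sub1set vW finset.subsetI subsetD1 vs andbT.
by case: (clique s); case: (_ == n); case: (s \subset W);
  case: (s \subset lk L v).
Qed.

Lemma iclique_notin n v W s : v \notin s ->
  iclique n W s = iclique n (W :\ v)%SET s.
Proof. by move=> vs; rewrite /iclique subsetD1 vs andbT. Qed.

End Cliques.

Section Koszul.
Variables (F : fieldType) (V : finType) (L : simplicial_complex V).
Variables (M : lmodType F) (T : V -> {linear M -> M}).
Implicit Types (s t W U : {set V}) (u v w : V) (b c : {set V} -> M).

Definition inc_sign v s : F :=
  (-1) ^+ #|[set w in s | (enum_rank w < enum_rank v)%N]|.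

(** Chains are coefficient functions on all vertex sets, so the differential collects at s what
    comes from the sets with one more vertex. The restriction to cliques is left to [supported]. *)
Definition koszul c s : M :=
  \sum_(v | v \notin s) inc_sign v s *: T v (c (v |: s)%SET).

Definition supported n W c := forall s, ~~ iclique L n W s -> c s = 0.

Lemma supportedS n W U c : U \subset W -> supported n U c -> supported n W c.
Proof.
move=> UW h s sW; apply: h; apply: contra sW => /and3P[h1 h2 h3].
by rewrite /iclique h1 h2 (subset_trans h3).
Qed.

Lemma koszulD b c s : koszul (fun t => b t + c t) s = koszul b s + koszul c s.
Proof.
by rewrite /koszul -big_split; apply: eq_bigr => v _; rewrite linearD scalerDr.
Qed.

Lemma koszulZ a c s : koszul (fun t => a *: c t) s = a *: koszul c s.
Proof.
rewrite /koszul scaler_sumr; apply: eq_bigr => v _.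
by rewrite linearZ !scalerA mulrC.
Qed.

Lemma koszulB b c s : koszul (fun t => b t - c t) s = koszul b s - koszul c s.
Proof.
rewrite -scaleN1r -koszulZ -koszulD; congr (koszul _ s).
by apply/funext => t; rewrite scaleN1r.
Qed.

Lemma supported_koszul n W c :
  supported n.+1 W c -> supported n W (koszul c).
Proof.
move=> h s sn; apply: big1 => v vs; rewrite h ?linear0 ?scaler0//.
apply: contra sn => /and3P[h1 h2 h3]; apply/and3P; split.
- by apply: cliqueS h1; exact: subsetUr.
- by move: h2; rewrite cardsU1 vs.
- by apply: subset_trans h3; exact: subsetUr.
Qed.

Lemma inc_signU1 u v s : v \notin s ->
  inc_sign u (v |: s)%SET =
  (-1) ^+ (enum_rank v < enum_rank u)%N * inc_sign u s.
Proof.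
move=> vs; rewrite /inc_sign -exprD; congr (_ ^+ _).
case: (boolP (enum_rank v < enum_rank u)%N) => vu.
  rewrite (_ : [set w in _ | _] =
    (v |: [set w in s | (enum_rank w < enum_rank u)%N])%SET).
    by rewrite cardsU1 inE (negbTE vs).
  apply/setP => w; rewrite !inE; case: eqVneq => [->|//].
  by rewrite vu.
rewrite add0n; apply: eq_card => w; rewrite !inE.
by case: eqVneq => [->|//]; rewrite (negbTE vu) (negbTE vs).
Qed.

Hypothesis TC : forall u v m, adjacent L u v -> T u (T v m) = T v (T u m).

Lemma koszul_koszul n c s : supported n setT c -> koszul (koszul c) s = 0.
Proof.
move=> h.
pose t v u := (inc_sign v s * inc_sign u (v |: s)%SET) *:
  T v (T u (c (u |: (v |: s))%SET)).
(* For adjacent u and v the operators commute and the signs are opposite; otherwise the enlarged set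
   is not a clique and both terms vanish. *)
have tA u v : u \notin s -> v \notin s -> u != v -> t v u = - t u v.
  move=> us vs uv; rewrite /t !inc_signU1// -scaleNr.
  have -> : (u |: (v |: s) = v |: (u |: s))%SET.
    by rewrite !finset.setUA (finset.setUC [set u]%SET).
  have [uvs|] := boolP (adjacent L u v); last first.
    move=> nuv; rewrite (h (v |: (u |: s))%SET) ?linear0 ?scaler0//.
    apply: contra nuv => /and3P[/cliqueP cl _ _].
    by apply: cl; rewrite ?inE ?eqxx ?orbT.
  rewrite (TC _ uvs); congr (_ *: _).
  have : enum_rank u != enum_rank v by rewrite (inj_eq enum_rank_inj).
  rewrite -val_eqE /=; case: ltngtP => //= _ _; rewrite expr0 expr1; ring.
rewrite /koszul (eq_bigr (fun v => \sum_(u | (u \notin s) && (u != v)) t v u)).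
  rewrite (exchange_big_dep (fun u => u \notin s))/=; last first.
    by move=> u v _ /andP[].
  (* Opposite terms are paired along the vertex order: in characteristic two, a sum equal to its own
     opposite need not be zero. *)
  pose lt u v := (enum_rank u < enum_rank v)%N.
  transitivity (\sum_(u | u \notin s) \sum_(v | (v \notin s) && lt u v) t v u
    + \sum_(u | u \notin s) \sum_(v | (v \notin s) && lt v u) t v u).
    rewrite -[RHS]big_split; apply: eq_bigr => u us /=.
    rewrite (bigID (lt u))/=; congr (_ + _); apply: eq_bigl => v.
      rewrite us -andbA /lt; congr andb.
      have [->|] := eqVneq u v; first by rewrite ltnn.
      by [].
    rewrite us -andbA /lt; congr andb.
    have [->|uv] := eqVneq u v; first by rewrite ltnn.
    have : enum_rank u != enum_rank v by rewrite (inj_eq enum_rank_inj).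
    by rewrite -val_eqE /=; case: ltngtP.
  rewrite [X in _ + X](exchange_big_dep (fun v => v \notin s))/=; last first.
    by move=> u v _ /andP[].
  rewrite -[LHS]big_split big1//= => v vs.
  rewrite [X in _ + X](eq_bigl (fun u => (u \notin s) && lt v u)); last first.
    by move=> u; rewrite vs.
  rewrite -[LHS]big_split big1//= => u /andP[us uv].
  rewrite tA// ?addNr//.
  by apply/eqP => e; move: uv; rewrite /lt e ltnn.
move=> v vs; rewrite linear_sum scaler_sumr; apply: eq_big => u.
  by rewrite !inE negb_or andbC.
by move=> us; rewrite linearZ scalerA.
Qed.

End Koszul.

(** * Exactness of the Salvetti complex *)

Section KoszulCone.
Variables (F : fieldType) (V : finType) (L : simplicial_complex V).
Variables (M : lmodType F) (T : V -> {linear M -> M}).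
Implicit Types (s t W U : {set V}) (u v w : V) (b c : {set V} -> M).

Lemma inc_sign0 v : inc_sign F v finset.set0 = 1.
Proof.
rewrite /inc_sign (_ : [set w in _ | _] = finset.set0)%SET ?cards0//.
by apply/setP => w; rewrite !inE.
Qed.

Lemma koszul0 s : koszul T (fun=> 0) s = 0.
Proof. by apply: big1 => v _; rewrite linear0 scaler0. Qed.

Lemma eq_koszul b c : b =1 c -> koszul T b =1 koszul T c.
Proof. by move=> e s; apply: eq_bigr => v _; rewrite e. Qed.

(** A vertex of largest rank changes no incidence sign of the others, so the components containing v
    form, without sign, a shifted copy of a Koszul complex. This is the quotient term of the mapping
    cone. *)
Lemma koszul_maxU1 n W v c s : v \notin s ->
  (forall w, w \in W -> w != v -> (enum_rank w < enum_rank v)%N) ->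
  supported L n W c ->
  koszul T c (v |: s)%SET =
  koszul T (fun t => if v \in t then 0 else c (v |: t)%SET) s.
Proof.
move=> vs vmax cW; rewrite /koszul [RHS](bigD1 v)//= setU11 linear0 scaler0.
rewrite add0r; apply: eq_big => u.
  by rewrite !inE negb_or andbC.
rewrite !inE negb_or => /andP[uv us].
rewrite eq_sym (negbTE uv) (negbTE vs) /=.
rewrite (finset.setUCA [set u]%SET).
have [cl|ncl] := boolP (iclique L n W (v |: (u |: s))%SET); last first.
  by rewrite cW// linear0 !scaler0.
have uW : u \in W.
  by case/and3P: cl => _ _ /subsetP; apply; rewrite !inE eqxx orbT.
by rewrite inc_signU1// ltnNge ltnW ?vmax// mul1r.
Qed.

End KoszulCone.

Lemma subrACA (Z : zmodType) (a b c d : Z) : a - b - (c - d) = a - c - (b - d).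
Proof.
rewrite !opprB -!addrA; congr (_ + _).
by rewrite addrCA [RHS]addrCA [- b - c]addrC.
Qed.

Lemma sub_split (Z : zmodType) (b a c : Z) : a - c = (a - b) + (b - c).
Proof. by rewrite addrA subrK. Qed.

(** * Exactness over the group ring, by adding one vertex at a time *)

Section GroupRing.
Variables (F : fieldType) (V : finType) (L : simplicial_complex V).
Local Notation A := (malg (raag L) F).
Implicit Types (s t W U : {set V}) (u v w : V) (b c : {set V} -> A).
Implicit Types (g h : raag L) (x y : A).

Definition rmul g x : A := mext (fun h => bas (h * g)%g) x.

HB.instance Definition _ g :=
  GRing.isLinear.Build F A A _ (rmul g) (mext_is_linear _).

Lemma rmul_bas g h : rmul g (bas h) = bas (h * g)%g.
Proof. exact: mext_bas. Qed.

Lemma rmulM g h x : rmul g (rmul h x) = rmul (h * g)%g x.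
Proof.
apply: (eq_malg_linear (f := rmul g \o rmul h)) => k /=.
by rewrite !rmul_bas mulgA.
Qed.

Lemma rmulB g x y : rmul g (x - y) = rmul g x - rmul g y.
Proof. exact: linearB. Qed.

Definition gen_diff v x : A := rmul (gen L v) x - x.

Lemma gen_diff_linear v : linear (gen_diff v).
Proof.
move=> a x y; rewrite /gen_diff linearP scalerBr opprD addrACA.
by [].
Qed.

HB.instance Definition _ v :=
  GRing.isLinear.Build F A A _ (gen_diff v) (gen_diff_linear v).

Lemma gen_diffC u v x : adjacent L u v ->
  gen_diff u (gen_diff v x) = gen_diff v (gen_diff u x).
Proof.
move=> uv; rewrite /gen_diff !rmulB !rmulM (gen_commute uv).
exact: subrACA.
Qed.

Local Notation dK := (koszul (fun v => gen_diff v : {linear A -> A})).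

(** The left ideal generated by the g_u - 1 for u in U, written as boundaries in degree 0 so that it
    serves the exactness induction. *)
Definition in_span U x := exists2 b, supported L 1 U b & dK b finset.set0 = x.

Lemma in_spanD U x y : in_span U x -> in_span U y -> in_span U (x + y).
Proof.
move=> [b sb <-] [c sc <-]; exists (fun t => b t + c t); last exact: koszulD.
by move=> s h; rewrite sb ?sc ?addr0.
Qed.

Lemma in_spanZ U a x : in_span U x -> in_span U (a *: x).
Proof.
move=> [b sb <-]; exists (fun t => a *: b t); last exact: koszulZ.
by move=> s h; rewrite sb ?scaler0.
Qed.

Lemma in_span0 U : in_span U 0.
Proof. by exists (fun=> 0) => //; exact: koszul0. Qed.

Lemma clique1 v : clique L [set v]%SET.
Proof. by apply/cliqueP => a b /set1P -> /set1P ->; rewrite eqxx. Qed.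

Lemma in_span_diff U u x : u \in U -> in_span U (gen_diff u x).
Proof.
move=> uU; exists (fun t => if t == [set u]%SET then x else 0).
  move=> s; case: eqP => // -> /negP[]; rewrite /iclique clique1 cards1.
  by rewrite sub1set uU.
rewrite /koszul (bigD1 u) ?inE//= finset.setU0 eqxx inc_sign0 scale1r.
rewrite big1 ?addr0// => v /andP[_ vu]; rewrite finset.setU0.
by rewrite (inj_eq finset.set1_inj) (negbTE vu) linear0 scaler0.
Qed.

Lemma in_span_retr U h g : in_span U (bas (h * retr U g)%g - bas h).
Proof.
elim/raag_ind: g => [|g v IH|g v IH].
- rewrite retr1 mulg1 subrr; exact: in_span0.
- rewrite retrMgen; case: ifP => [vU|_]; last exact: IH.
  rewrite mulgA (sub_split (bas (h * retr U g)%g)).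
  by apply: in_spanD IH; rewrite -(rmul_bas (gen L v)); exact: in_span_diff.
- rewrite retrMgenV; case: ifP => [vU|_]; last exact: IH.
  rewrite mulgA (sub_split (bas (h * retr U g)%g)).
  apply: in_spanD IH; set k := (h * retr U g)%g.
  rewrite -opprB -scaleN1r -{1}(mulgVK (gen L v) k) -(rmul_bas (gen L v)).
  by apply: in_spanZ; exact: in_span_diff.
Qed.

Definition crep_map U x : A := mext (fun h => bas (crep U h)) x.

(** Modulo this left ideal a group element depends only on its coset; hence an element killed by
    [crep_map U] belongs to the ideal. *)
Lemma in_span_crep U x : in_span U (x - crep_map U x).
Proof.
rewrite {1}[x]malg_decomp /crep_map /mext -sumrB.
elim: (msupp x : seq _) => [|h r IH].
  by rewrite big_nil; exact: in_span0.
rewrite big_cons; apply: in_spanD => //.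
rewrite -scalerBr; apply: in_spanZ.
by rewrite -{1}(mulgVK (retr U h) h); exact: in_span_retr.
Qed.

Lemma mext_gen_diff (phi : raag L -> F^o) v x :
  mext phi (gen_diff v x) =
  mext (fun h => phi (h * gen L v)%g - phi h : F^o) x.
Proof.
apply: (eq_malg_linear (f := mext phi \o gen_diff v)) => h /=.
by rewrite /gen_diff linearB /= rmul_bas !mext_bas.
Qed.

(* The functional [lam] detects the coset of h: it vanishes on the image of *)
(* [gen_diff w] for w in W other than v.                                    *)
Lemma in_span_cycle W v c : v \in W -> supported L 1 W c ->
  dK c finset.set0 = 0 ->
  in_span ((W :\ v) :&: lk L v)%SET (c [set v]%SET).
Proof.
move=> vW cW c0; set U := (_ :&: _)%SET.
suff e0 : crep_map U (c [set v]%SET) = 0.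
  by rewrite -[c _]subr0 -e0; exact: in_span_crep.
have UE : (W :&: lk L v)%SET = U.
  apply/setP => u; rewrite !inE; case: eqVneq => //= ->.
  by rewrite /adjacent eqxx andbF.
have lamE h : mext (fun g => (crep U g == crep U h)%:R : F^o) (c [set v]%SET) = 0.
  (* Along g_v, [lam] increases by one exactly when g is in the coset of h both modulo W and modulo
     the link, that is, modulo [U]. Applied to the relation [c0], it therefore reads off one coset
     coefficient of the component at v. *)
  pose lam g : F^o := if crep W g == crep W h then fox 1 v h g else 0.
  have := congr1 (mext lam) c0; rewrite linear0 linear_sum (bigD1 v) ?inE//=.
  rewrite big1 ?addr0.
    rewrite inc_sign0 scale1r finset.setU0 mext_gen_diff => <-.
    apply: eq_mext => g; rewrite /lam crepMgen// foxMgen eqxx /=.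
    have [e1|n1] := eqVneq (crep W g) (crep W h).
      have [e2|n2] := eqVneq (crep (lk L v) g) (crep (lk L v) h).
        by rewrite -UE (crepI e1 e2) eqxx addrAC subrr add0r.
      rewrite subrr; case: eqVneq => // e.
      by case/eqP: n2; apply: crepS e; exact: subsetIr.
    rewrite subrr; case: eqVneq => // e; case/eqP: n1; apply: crepS e.
    by rewrite -UE subsetIl.
  move=> w /andP[_ wv]; rewrite inc_sign0 scale1r finset.setU0 mext_gen_diff.
  have [wW|wW] := boolP (w \in W).
    rewrite (@eq_mext _ _ _ _ (fun=> 0)) => [|g]; first exact: mext0.
    by rewrite /lam crepMgen// foxMgen (negbTE wv) subrr.
  rewrite cW ?linear0//; apply: contra wW => /and3P[_ _].
  by rewrite sub1set.
apply/malgP => h; rewrite mcoeff0.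
have -> : mcoeff h (crep_map U (c [set v]%SET)) =
    mext (fun g => (crep U g == h)%:R : F^o) (c [set v]%SET).
  rewrite /crep_map /mext (raddf_sum (mcoeff h)); apply: eq_bigr => g _.
  by rewrite /= mcoeffZ mcoeffU.
(* If h is not a canonical representative, it is no value of [crep U] and its coefficient is
   zero. *)
have [e|ne] := eqVneq (crep U h) h; first by rewrite -[RHS](lamE h) e.
rewrite -[RHS](mext0 F^o (c [set v]%SET)).
apply: (@eq_mext F (raag L) F^o) => g.
by case: eqVneq => // e; move: ne; rewrite -e crep_id eqxx.
Qed.

(** The bound k on ranks makes the removed vertex v the largest one, as [koszul_maxU1] requires. The
    v-part of a cycle is a cycle over the link; once it is bounded there, the remainder avoids v. *)
Lemma koszul_exact_rank k : forall W n c,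
  (forall w, w \in W -> (enum_rank w < k)%N) ->
  supported L n.+1 W c -> (forall s, dK c s = 0) ->
  exists2 b, supported L n.+2 W b & forall s, dK b s = c s.
Proof.
elim: k => [|k IH] W n c Wk cW c0.
  exists (fun=> 0) => // s; rewrite koszul0 cW//.
  apply/and3P => -[_ /eqP sn /subsetP sW].
  have /card_gt0P[w /sW /Wk] : (0 < #|s|)%N by rewrite sn.
  by rewrite ltn0.
have [/exists_inP[v vW /eqP vk]|/exists_inPn nv] :=
  boolP [exists v in W, enum_rank v == k :> nat]; last first.
  apply: IH => // w wW; have := Wk _ wW; rewrite ltnS leq_eqVlt.
  by rewrite (negbTE (nv _ wW)).
have vmax w : w \in W -> w != v -> (enum_rank w < enum_rank v)%N.
  move=> wW wv; have := Wk _ wW; rewrite ltnS -vk leq_eqVlt.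
  by rewrite val_eqE (inj_eq enum_rank_inj) (negbTE wv).
pose U := ((W :\ v) :&: lk L v)%SET.
have UW : U \subset (W :\ v)%SET by exact: subsetIl.
have WW : (W :\ v)%SET \subset W by exact: subD1set.
have vU : v \notin U by rewrite !inE eqxx.
have Uk w : w \in (W :\ v)%SET -> (enum_rank w < k)%N.
  by rewrite !inE -vk => /andP[wv wW]; exact: vmax.
pose bv t := if v \in t then 0 else c (v |: t)%SET.
have bvU : supported L n U bv.
  move=> s ns; rewrite /bv; case: ifPn => // vs.
  by apply: cW; rewrite iclique_lk.
have bv0 s : dK bv s = 0.
  have [vs|vs] := boolP (v \in s); last by rewrite -(koszul_maxU1 _ vs vmax cW).
  by apply: big1 => u us; rewrite /bv inE vs orbT linear0 scaler0.
have [b' b'U b'E] : exists2 b', supported L n.+1 U b' & forall s, dK b' s = bv s.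
  (* In degree 0 of the link complex every chain is a cycle, so the induction says nothing and the
     Fox derivative argument takes over. *)
  case: n cW bvU => [|n] cW bvU; last first.
    by apply: IH => // w wU; apply: Uk; exact: (subsetP UW).
  have [b' b'U e] := in_span_cycle vW cW (c0 finset.set0).
  exists b' => // s; have [->|s0] := eqVneq s finset.set0.
    by rewrite e /bv inE finset.setU0.
  have ns : ~~ iclique L 0 U s by rewrite /iclique cards_eq0 (negbTE s0) andbF.
  by rewrite bvU//; apply: supported_koszul ns.
(* The cone on [b'] with apex v: its boundary agrees with c on every set containing v. *)
pose e s := if v \in s then b' (s :\ v)%SET else 0.
have eW : supported L n.+2 W e.
  move=> s; rewrite /e; case: ifPn => // vs; rewrite -{1}(setD1K vs).
  by rewrite iclique_lk ?setD11//; exact: b'U.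
have eE s : v \notin s -> dK e (v |: s)%SET = c (v |: s)%SET.
  move=> vs; rewrite (koszul_maxU1 _ vs vmax eW).
  rewrite (@eq_koszul _ _ _ _ _ b') => [|t]; first by rewrite b'E /bv (negbTE vs).
  case: ifPn => vt; last by rewrite /e setU11 setU1K.
  by rewrite b'U//; apply: contra vU => /and3P[_ _ /subsetP]; exact.
have c'W : supported L n.+1 (W :\ v)%SET (fun s => c s - dK e s).
  move=> s ns; have [vs|vs] := boolP (v \in s).
    by rewrite -(setD1K vs) eE ?setD11// subrr.
  have ns' : ~~ iclique L n.+1 W s by rewrite (iclique_notin _ _ _ vs).
  by rewrite cW// (supported_koszul _ eW)// subrr.
have eT : supported L n.+2 finset.setT e by apply: supportedS eW; exact: subsetT.
have c'0 s : dK (fun s => c s - dK e s) s = 0.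
  have kk : dK (dK e) s = 0.
    by apply: (koszul_koszul _ _ eT) => u w x; exact: gen_diffC.
  rewrite (koszulB _ c (dK e)) c0 kk; exact: subrr.
have [b'' b''W b''E] := IH _ _ _ Uk c'W c'0.
exists (fun s => b'' s + e s) => [s ns|s].
  by rewrite eW// (supportedS WW b''W) ?addr0.
by rewrite koszulD b''E subrK.
Qed.

Lemma koszul_exact n c : supported L n.+1 finset.setT c ->
  (forall s, dK c s = 0) ->
  exists2 b, supported L n.+2 finset.setT b & forall s, dK b s = c s.
Proof. exact: (@koszul_exact_rank #|V|). Qed.

Definition augm x : F^o := mext (fun=> 1 : F^o) x.

Lemma koszul_augm_exact x : augm x = 0 -> in_span finset.setT x.
Proof.
move=> x0; rewrite -[x]subr0.
suff <- : crep_map finset.setT x = 0 by exact: in_span_crep.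
have -> : crep_map finset.setT x = augm x *: bas 1%g; last first.
  by rewrite x0 scale0r.
rewrite /crep_map /augm /mext scaler_suml; apply: eq_bigr => g _.
by rewrite crepT -[X in _ = X *: _]/(mcoeff g x * 1) mulr1.
Qed.

End GroupRing.

(** * Comparison of projective resolutions *)

Definition mk_linear (F : fieldType) (M N : lmodType F) (f : M -> N)
  (lf : linear f) : {linear M -> N} :=
  HB.pack f (GRing.isLinear.Build F M N _ f lf).

(** Below, [P] carries what the next lifting needs and [Q] is the equation of a chain map or of a
    homotopy. *)
Lemma dependent_choice_nat (X : nat -> Type) (P : forall n, X n -> Prop)
    (Q : forall n, X n -> X n.+1 -> Prop) :
  (exists x, P 0%N x) ->
  (forall n x, P n x -> exists2 y, P n.+1 y & Q n x y) ->
  exists2 f : forall n, X n, (forall n, P n (f n)) &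
    forall n, Q n (f n) (f n.+1).
Proof.
move=> /cid[x0 P0] step.
pose next n (u : {x : X n | P n x}) : {x : X n.+1 | P n.+1 x} :=
  let y := cid2 (step n (sval u) (svalP u)) in exist _ (s2val y) (s2valP y).
pose f := fix f n : {x : X n | P n x} :=
  if n is m.+1 then next m (f m) else exist _ x0 P0.
exists (fun n => sval (f n)) => n; first exact: svalP.
exact: (s2valP' (cid2 (step n _ (svalP (f n))))).
Qed.

Section Resolutions.
Variables (F : fieldType) (K : groupType).

Record gmod := GMod {
  gmod_car :> lmodType F;
  gact : K -> {linear gmod_car -> gmod_car};
  gact1 : forall x, gact 1%g x = x;
  gactM : forall k l x, gact (k * l)%g x = gact k (gact l x)
}.

Arguments gact {g} k.

Definition equivariant (P Q : gmod) (f : P -> Q) :=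
  forall k x, f (gact k x) = gact k (f x).

(** Projectivity, with the image of phi contained in that of d instead of d surjective, so that it
    applies directly to a differential and its cycles. *)
Definition lifting (P : gmod) :=
  forall (A B : gmod) (d : {linear A -> B}) (phi : {linear P -> B}),
    equivariant d -> equivariant phi -> (forall x, exists y, d y = phi x) ->
    exists2 psi : {linear P -> A}, equivariant psi &
      forall x, d (psi x) = phi x.

Definition triv_gmod : gmod :=
  @GMod F^o (fun=> idfun) (fun=> erefl) (fun _ _ _ => erefl).

Record resolution := Resolution {
  res :> nat -> gmod;
  dres : forall n, {linear res n.+1 -> res n};
  eres : {linear res 0%N -> triv_gmod};
  dres_equiv : forall n, equivariant (dres n);
  eres_equiv : equivariant eres;
  eres_surj : forall a, exists x, eres x = a;
  dresK : forall n x, dres n (dres n.+1 x) = 0;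
  eresK : forall x, eres (dres 0 x) = 0;
  dres_exact : forall n x, dres n x = 0 -> exists y, dres n.+1 y = x;
  eres_exact : forall x, eres x = 0 -> exists y, dres 0 y = x;
  res_lift : forall n, lifting (res n)
}.

Definition rcycle (C : resolution) n : C n -> Prop :=
  match n with
  | 0 => fun x => eres C x = 0
  | m.+1 => fun x => dres C m x = 0
  end.

Lemma rcycleP (C : resolution) n x :
  rcycle x <-> exists y, dres C n y = x.
Proof.
case: n x => [|n] x; split => /=.
- exact: eres_exact.
- by move=> [y <-]; exact: eresK.
- exact: dres_exact.
- by move=> [y <-]; exact: dresK.
Qed.

Definition chain_map (C D : resolution) (f : forall n, {linear C n -> D n}) :=
  [/\ forall n, equivariant (f n),
      forall x, eres D (f 0%N x) = eres C x &
      forall n x, dres D n (f n.+1 x) = f n (dres C n x)].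

Lemma chain_map_exists (C D : resolution) :
  exists f : forall n, {linear C n -> D n}, chain_map f.
Proof.
have [||f f1 f2] := @dependent_choice_nat (fun n => {linear C n -> D n})
  (fun n f => [/\ equivariant f, (forall x, rcycle x -> rcycle (f x)) &
     match n return (C n -> D n) -> Prop with
     | 0 => fun f => forall x, eres D (f x) = eres C x
     | _ => fun=> True end f])
  (fun n f g => forall x, dres D n (g x) = f (dres C n x)).
- have [|||f fE fe] := @res_lift C 0 _ _ (eres D) (eres C).
  + exact: eres_equiv.
  + exact: eres_equiv.
  + by move=> x; exact: eres_surj (eres C x).
  by exists f; split => // x /=; rewrite fe.
- move=> n f [fE fc _].
  have [|k x|x|g gE ge] := @res_lift C n.+1 _ _ (dres D n) (f \o dres C n).
  + exact: dres_equiv.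
  + by rewrite /= dres_equiv fE.
  + by apply/rcycleP; apply: fc; apply/rcycleP; exists x.
  exists g => //; split => // x /= dx.
  by rewrite ge /= dx linear0.
exists f; split => [n|x|//]; first by have [] := f1 n.
by have [_ _] := f1 0%N; apply.
Qed.

Lemma chain_homotopy_exists (C D : resolution)
    (f g : forall n, {linear C n -> D n}) : chain_map f -> chain_map g ->
  exists h : forall n, {linear C n -> D n.+1},
  [/\ forall n, equivariant (h n),
      forall x, dres D 0 (h 0%N x) = f 0%N x - g 0%N x &
      forall n x, dres D n.+1 (h n.+1 x) =
        f n.+1 x - g n.+1 x - h n (dres C n x)].
Proof.
move=> [fE fe fd] [gE ge gd].
have [||h h1 h2] := @dependent_choice_nat (fun n => {linear C n -> D n.+1})
  (fun n h => [/\ equivariant h,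
     (forall x, rcycle x -> dres D n (h x) = f n x - g n x) &
     match n return (C n -> D n.+1) -> Prop with
     | 0 => fun h => forall x, dres D 0 (h x) = f 0%N x - g 0%N x
     | _ => fun=> True end h])
  (fun n h h' => forall x, dres D n.+1 (h' x) =
        f n.+1 x - g n.+1 x - h (dres C n x)).
- have [|k x|x|h hE he] := @res_lift C 0 _ _ (dres D 0) (f 0%N \- g 0%N).
  + exact: dres_equiv.
  + by rewrite /= fE gE linearB.
  + by apply/(@rcycleP D 0); rewrite /= linearB fe ge subrr.
  by exists h.
- move=> n h [hE hc _].
  have [|k x|x|h' h'E h'e] := @res_lift C n.+1 _ _ (dres D n.+1)
      ((f n.+1 \- g n.+1) \- (h \o dres C n)).
  + exact: dres_equiv.
  + by rewrite /= fE gE dres_equiv hE !linearB.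
  + apply/(@rcycleP D n.+1); rewrite /= !linearB fd gd hc ?subrr//.
    by apply/rcycleP; exists x.
  exists h' => //; split => // x /= dx.
  by rewrite h'e /= dx linear0 subr0.
exists h; split => [n|x|//]; first by have [] := h1 n.
by have [_ _] := h1 0%N; apply.
Qed.

(** Coinvariants presented by a projection with a linear, not equivariant, section instead of a
    quotient. The universal property becomes [coinv_univ]: an invariant map factors through the
    projection by way of the section. *)
Record coinvariants (C : resolution) := Coinvariants {
  coinv :> nat -> lmodType F;
  coproj : forall n, {linear C n -> coinv n};
  cosec : forall n, {linear coinv n -> C n};
  cosecK : forall n x, coproj n (cosec n x) = x;
  coproj_act : forall n k x, coproj n (gact k x) = coproj n x;
  coinv_univ : forall n (N : lmodType F) (phi : {linear C n -> N}),
    (forall k x, phi (gact k x) = phi x) ->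
    forall x, phi (cosec n (coproj n x)) = phi x;
  dcoinv : forall n, {linear coinv n.+1 -> coinv n};
  dcoinvE : forall n x, dcoinv n (coproj n.+1 x) = coproj n (dres C n x)
}.

(** The prefix stands for coinvariants: these are homological cycles, and in degree 0 the
    augmentation is dropped. *)
Definition cocycle C (cC : coinvariants C) n : set (cC n) :=
  match n with
  | 0 => [set: _]%classic
  | m.+1 => [set x | dcoinv cC m x = 0]%classic
  end.

Definition coboundary C (cC : coinvariants C) n : set (cC n) :=
  range (dcoinv cC n).

Variable R : realType.

Lemma quotient_dim_le (C D : lmodType F) (Z B : set C) (Z' B' : set D)
    (f : {linear C -> D}) :
  (forall n (a : 'I_n -> F) e, (forall j, Z (e j)) ->
    Z (\sum_(j < n) a j *: e j)) ->
  (forall z, Z z -> Z' (f z)) -> (forall z, Z z -> B' (f z) -> B z) ->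
  (quotient_dim R Z B <= quotient_dim R Z' B')%E.
Proof.
move=> Zlin fZ fB; apply: ereal_sup_le => _ [n [e Ze ind] <-].
exists n => //; exists (f \o e) => [j|a].
  exact: fZ.
move=> sB; apply: ind; apply: fB; first exact: Zlin.
by rewrite linear_sum; under eq_bigr do rewrite linearZ.
Qed.

Definition comap C D (cC : coinvariants C) (cD : coinvariants D)
    (f : forall n, {linear C n -> D n}) n : {linear cC n -> cD n} :=
  coproj cD n \o f n \o cosec cC n.

Lemma comapE C D (cC : coinvariants C) (cD : coinvariants D)
    (f : forall n, {linear C n -> D n}) n x : equivariant (f n) ->
  comap cC cD f n (coproj cC n x) = coproj cD n (f n x).
Proof.
move=> fE; apply: (@coinv_univ _ cC n _ (coproj cD n \o f n)) => k y /=.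
by rewrite fE coproj_act.
Qed.

Lemma comap_d C D (cC : coinvariants C) (cD : coinvariants D)
    (f : forall n, {linear C n -> D n}) n x : chain_map f ->
  dcoinv cD n (comap cC cD f n.+1 x) = comap cC cD f n (dcoinv cC n x).
Proof.
move=> [fE _ fd]; rewrite -[x]cosecK comapE// dcoinvE fd.
by rewrite dcoinvE comapE.
Qed.

Lemma cocycle_lin C (cC : coinvariants C) n m (a : 'I_m -> F) e :
  (forall j, cocycle (cC := cC) (n := n) (e j)) ->
  cocycle (\sum_(j < m) a j *: e j).
Proof.
case: n e => [//|n] e /= h; rewrite linear_sum big1// => j _.
by rewrite linearZ /= h scaler0.
Qed.

Lemma comap_homotopy C D (cC : coinvariants C) (cD : coinvariants D)
    (f : forall n, {linear C n -> D n}) (g : forall n, {linear D n -> C n}) n x :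
  chain_map f -> chain_map g -> cocycle x ->
  coboundary (comap cD cC g n (comap cC cD f n x) - x).
Proof.
move=> cf cg cx.
have cgf : chain_map (fun n => g n \o f n : {linear C n -> C n}).
  case: cf cg => [fE fe fd] [gE ge gd]; split => [m k y|y|m y] /=.
  - by rewrite fE gE.
  - by rewrite ge fe.
  - by rewrite gd fd.
have cid : chain_map (fun n => idfun : {linear C n -> C n}) by split.
have [h [hE h0 hS]] := chain_homotopy_exists cgf cid.
have [fE _ _] := cf; have [gE _ _] := cg.
pose y := cosec cC n x.
have xE : x = coproj cC n y by rewrite cosecK.
exists (coproj cC n.+1 (h n y)) => //.
have -> : comap cC cD f n x = coproj cD n (f n y) by [].
rewrite comapE// {1}xE -linearB dcoinvE.
case: n x y cx xE => [|n] x y cx xE; first by rewrite h0.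
rewrite hS [LHS]linearB /=.
(* The lift y need not be a cycle. But the projection of h is invariant, hence depends only on the
   class of the boundary of y in the coinvariants, which is zero. *)
suff -> : coproj cC n.+1 (h n (dres C n y)) = 0 by rewrite subr0.
rewrite -[LHS]/((coproj cC n.+1 \o h n) _).
rewrite -(@coinv_univ _ cC n _ (coproj cC n.+1 \o h n)) => [|k z].
  by rewrite -dcoinvE -xE cx !linear0.
by rewrite /= hE coproj_act.
Qed.

Lemma quotient_dim_coinv_le C D (cC : coinvariants C) (cD : coinvariants D) n :
  (quotient_dim R (@cocycle _ cC n) (@coboundary _ cC n) <=
   quotient_dim R (@cocycle _ cD n) (@coboundary _ cD n))%E.
Proof.
have [f cf] := chain_map_exists C D.
have [g cg] := chain_map_exists D C.
apply: (quotient_dim_le (f := comap cC cD f n)).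
- by move=> m a e; exact: cocycle_lin.
- by case: n => [//|n] z /= dz; rewrite comap_d// dz linear0.
- move=> z cz [y _ yE].
  have [t _ tE] := comap_homotopy cD cf cg cz.
  exists (comap cD cC g n.+1 y - t) => //.
  by rewrite linearB /= comap_d// yE tE opprB addrC subrK.
Qed.

Lemma quotient_dim_coinv C D (cC : coinvariants C) (cD : coinvariants D) n :
  quotient_dim R (@cocycle _ cC n) (@coboundary _ cC n) =
  quotient_dim R (@cocycle _ cD n) (@coboundary _ cD n).
Proof. by apply/eqP; rewrite eq_le !quotient_dim_coinv_le. Qed.

End Resolutions.
Arguments gact {F K g} k.

(** * Projectivity of free modules and of their finite sums *)

Section FreeModules.
Variables (F : fieldType) (K : groupType).

Section Malg.
Variables (S : choiceType) (aS : K -> S -> S) (rep : S -> K).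
Hypothesis aS1 : forall s, aS 1%g s = s.
Hypothesis aSM : forall k l s, aS (k * l)%g s = aS k (aS l s).
Hypothesis repM : forall k s, rep (aS k s) = (k * rep s)%g.

Definition malg_act k : {linear malg S F -> malg S F} :=
  mext (fun s => bas (aS k s)).

Lemma malg_act_bas k s : malg_act k (bas s) = bas (aS k s).
Proof. exact: mext_bas. Qed.

Lemma malg_act1 x : malg_act 1%g x = x.
Proof.
apply: (eq_malg_linear (f := malg_act 1%g) (g := idfun)) => s.
by rewrite malg_act_bas aS1.
Qed.

Lemma malg_actM k l x : malg_act (k * l)%g x = malg_act k (malg_act l x).
Proof.
apply: (eq_malg_linear (f := malg_act (k * l)%g)
  (g := malg_act k \o malg_act l)) => s.
by rewrite /= !malg_act_bas aSM.
Qed.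

Definition malg_gmod : gmod F K := GMod malg_act1 malg_actM.

Lemma malg_equivariant (Q : gmod F K) (f : {linear malg_gmod -> Q}) :
  (forall k s, f (bas (aS k s)) = gact k (f (bas s))) -> equivariant f.
Proof.
move=> fE k x.
apply: (eq_malg_linear (f := f \o malg_act k) (g := gact k \o f)) => s /=.
by rewrite malg_act_bas fE.
Qed.

(** The equivariant map [rep] expresses that K acts freely: the points over 1 represent the orbits.
    Lifts are chosen at these points and transported by K. *)
Lemma malg_lifting : lifting malg_gmod.
Proof.
move=> A B d phi dE phiE ex.
have [ch chE] := choice (fun s => ex (bas s)).
pose psi : {linear malg S F -> A} :=
  mext (fun s => gact (rep s) (ch (aS (rep s)^-1%g s))).
have psiE s : psi (bas s) = gact (rep s) (ch (aS (rep s)^-1%g s)).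
  exact: mext_bas.
exists psi => [|x].
  apply: malg_equivariant => k s; rewrite !psiE repM gactM.
  by congr (gact k (gact _ (ch _))); rewrite -aSM invgM mulgVK.
apply: (eq_malg_linear (f := d \o psi)) => s /=.
rewrite psiE dE chE -phiE; congr (phi _).
by rewrite [LHS]malg_act_bas -aSM mulgV aS1.
Qed.

End Malg.

Section Ffun.
Variables (P : gmod F K) (I : finType).

Definition ffun_map (M N : lmodType F) (f : M -> N) (c : {ffun I -> M}) :
  {ffun I -> N} := [ffun i => f (c i)].

Lemma ffun_map_linear (M N : lmodType F) (f : {linear M -> N}) :
  linear (ffun_map f).
Proof.
by move=> a c c'; apply/ffunP => i; rewrite !ffunE linearP.
Qed.

HB.instance Definition _ (M N : lmodType F) (f : {linear M -> N}) :=
  GRing.isLinear.Build F {ffun I -> M} {ffun I -> N} _ (ffun_map f)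
    (ffun_map_linear f).

Definition ffun_act k : {linear {ffun I -> P} -> {ffun I -> P}} :=
  ffun_map (gact k).

Lemma ffun_act1 x : ffun_act 1%g x = x.
Proof. by apply/ffunP => i; rewrite ffunE gact1. Qed.

Lemma ffun_actM k l x : ffun_act (k * l)%g x = ffun_act k (ffun_act l x).
Proof. by apply/ffunP => i; rewrite !ffunE gactM. Qed.

Definition ffun_gmod : gmod F K := GMod ffun_act1 ffun_actM.

Definition ffun_inj (M : lmodType F) i (x : M) : {ffun I -> M} :=
  [ffun j => if j == i then x else 0].

Lemma ffun_inj_linear (M : lmodType F) i : linear (@ffun_inj M i).
Proof.
move=> a x y; apply/ffunP => j; rewrite !ffunE; case: eqP => // _.
by rewrite scaler0 addr0.
Qed.

HB.instance Definition _ (M : lmodType F) i :=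
  GRing.isLinear.Build F M {ffun I -> M} _ (@ffun_inj M i)
    (@ffun_inj_linear M i).

Lemma ffun_decomp (M : lmodType F) (c : {ffun I -> M}) :
  c = \sum_i ffun_inj i (c i).
Proof.
apply/ffunP => j; rewrite sum_ffunE (bigD1 j)//= ffunE eqxx big1 ?addr0//.
by move=> i ij; rewrite ffunE eq_sym (negbTE ij).
Qed.

Lemma ffun_lifting : lifting P -> lifting ffun_gmod.
Proof.
move=> liftP A B d phi dE phiE ex.
have [|psi psiE] := choice (P := fun i (f : {linear P -> A}) =>
    equivariant f /\ forall x, d (f x) = phi (ffun_inj i x)).
  move=> i.
  have [//|k x|x|f fE fe] := liftP A B d (phi \o @ffun_inj P i).
  + rewrite /= -phiE; congr (phi _); apply/ffunP => j.
    by rewrite !ffunE; case: eqP => // _; rewrite linear0.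
  + exact: ex.
  by exists f.
pose psis (c : {ffun I -> P}) := \sum_i psi i (c i).
have lin : linear psis.
  move=> a x y; rewrite /psis scaler_sumr -big_split; apply: eq_bigr => i _ /=.
  by rewrite !ffunE linearP.
pose psil : {linear ffun_gmod -> A} := mk_linear lin.
have psilE c : psil c = \sum_i psi i (c i) by [].
exists psil => [k x|x].
  rewrite !psilE linear_sum; apply: eq_bigr => i _.
  by rewrite ffunE; have [-> _] := psiE i.
rewrite psilE [in RHS](ffun_decomp x) !linear_sum.
by apply: eq_bigr => i _; have [_ ->] := psiE i.
Qed.

End Ffun.

End FreeModules.

(** * The bar resolution *)

Section BarResolution.
Variables (F : fieldType) (K : groupType).
Local Notation N n := {ffun 'I_n -> K}.

(* The n-simplices of the contractible space EK are the (n+1)-simplices of  *)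
(* the nerve of K, without their 0-th face, which is the projection to BK;  *)
(* K acts on the first entry.                                               *)
Definition bar_act n (k : K) (s : N n.+1) : N n.+1 :=
  [ffun j => if j == ord0 then (k * s j)%g else s j].

(** It has two roles: a section of the projection from EK to BK, and the cone operator that
    contracts the bar resolution. *)
Definition cons1 n (s : N n) : N n.+1 :=
  [ffun j => if unlift ord0 j is Some j' then s j' else 1%g].

Lemma bar_act1 n (s : N n.+1) : bar_act 1%g s = s.
Proof. by apply/ffunP => j; rewrite ffunE mul1g if_same. Qed.

Lemma bar_actM n k l (s : N n.+1) :
  bar_act (k * l)%g s = bar_act k (bar_act l s).
Proof. by apply/ffunP => j; rewrite !ffunE; case: eqP => //; rewrite mulgA. Qed.

Lemma bar_act_ord0 n k (s : N n.+1) : bar_act k s ord0 = (k * s ord0)%g.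
Proof. by rewrite ffunE eqxx. Qed.

Lemma inord_lift0 n (j : 'I_n.+1) : inord (n' := n.+1) j.+1 = lift ord0 j.
Proof. by apply: val_inj; rewrite [RHS]lift0 /= inordK ?ltnS ?leq_ord. Qed.

Lemma cons1_0 n (s : N n) : cons1 s ord0 = 1%g.
Proof. by rewrite ffunE unlift_none. Qed.

Lemma cons1_lift n (s : N n) j : cons1 s (lift ord0 j) = s j.
Proof. by rewrite ffunE liftK. Qed.

Lemma cons1_inord n (s : N n.+1) (j : 'I_n.+1) :
  cons1 s (inord (n' := n.+1) j.+1) = s j.
Proof. by rewrite inord_lift0 cons1_lift. Qed.

Lemma face0_act n k (s : N n.+1) : nerve_face 0 (bar_act k s) = nerve_face 0 s.
Proof.
apply/ffunP => j; rewrite !ffunE /=; case: n s j => [|n] s j; first by case: j.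
by rewrite inord_lift0.
Qed.

Lemma face0_cons1 n (s : N n) : nerve_face 0 (cons1 s) = s.
Proof.
apply/ffunP => j; rewrite ffunE /=; case: n s j => [|n] s j; first by case: j.
by rewrite cons1_inord.
Qed.

Lemma faceS_act n i k (s : N n.+2) :
  nerve_face i.+1 (bar_act k s) = bar_act k (nerve_face i.+1 s).
Proof.
apply/ffunP => j; rewrite !ffunE /= !ltnS eqSS inord_lift0 /=.
have -> : (inord j == ord0 :> 'I_n.+2) = (j == ord0).
  by rewrite -!val_eqE /= inordK// (leqW (ltn_ord j)).
by case: (ltngtP j i) => ji; case: eqP => // j0; rewrite ?mulgA//;
  move: ji; rewrite j0.
Qed.

Lemma face1_cons1 n (s : N n.+1) : nerve_face 1 (cons1 s) = s.
Proof.
apply/ffunP => j; rewrite ffunE ltnS ltn0 eqSS cons1_inord.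
case: eqP => // j0; rewrite (_ : inord j = ord0) ?cons1_0 ?mul1g//.
by apply: val_inj; rewrite /= inordK j0.
Qed.

Lemma faceSS_cons1 n i (s : N n.+2) :
  nerve_face i.+2 (cons1 s) = cons1 (nerve_face i.+1 s).
Proof.
apply/ffunP => j; rewrite ffunE cons1_inord.
case: (unliftP ord0 j) => [j' ->|->] /=.
  rewrite cons1_lift ffunE /bump leq0n add1n !ltnS !eqSS.
  have -> : inord (1 + j')%N = lift ord0 (inord j' : 'I_n.+2) :> 'I_n.+3.
    have jn : (j' < n.+1)%N := ltn_ord j'.
    by apply: val_inj; rewrite [RHS]lift0 /= !inordK ?add1n ?ltnS//; exact: ltnW.
  by rewrite liftK [RHS]ffunE inord_lift0 ltnS eqSS.
rewrite cons1_0 (_ : inord _ = ord0) ?cons1_0//.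
by apply: val_inj; rewrite /= inordK.
Qed.

Lemma face2_cons1 (s : N 1) : nerve_face 2 (cons1 s) = cons1 [ffun=> 1%g].
Proof.
apply/ffunP => j; rewrite ffunE ord1 /= cons1_0.
by rewrite (_ : inord 0 = ord0) ?cons1_0//; apply: val_inj; rewrite /= inordK.
Qed.

Lemma bar_act_cons1 n (s : N n.+1) :
  bar_act (s ord0) (cons1 (nerve_face 0 s)) = s.
Proof.
apply/ffunP => j; rewrite ffunE; case: (unliftP ord0 j) => [j' ->|->].
  rewrite cons1_lift ffunE /=; case: n s j j' => [|n] s j j'; first by case: j'.
  by rewrite inord_lift0.
by rewrite eqxx cons1_0 mulg1.
Qed.

Definition bar_mod n : gmod F K :=
  malg_gmod F (@bar_act1 n) (@bar_actM n).

Definition dbar n : {linear bar_mod n.+1 -> bar_mod n} :=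
  mext (fun s : N n.+2 =>
    \sum_(i < n.+2) (-1) ^+ i *: (bas (nerve_face i.+1 s) : malg (N n.+1) F)).

Definition ebar : {linear bar_mod 0 -> triv_gmod F K} := mext (fun=> 1 : F^o).

Lemma dbar_bas n s : dbar n (bas s) =
  \sum_(i < n.+2) (-1) ^+ i *: (bas (nerve_face i.+1 s) : malg (N n.+1) F).
Proof. exact: mext_bas. Qed.

Lemma ebar_bas s : ebar (bas s) = 1.
Proof. exact: mext_bas. Qed.

Lemma dbar_equiv n : equivariant (dbar n).
Proof.
apply: malg_equivariant => k s; rewrite !dbar_bas linear_sum.
apply: eq_bigr => i _; rewrite linearZ; congr (_ *: _).
by rewrite [RHS]malg_act_bas faceS_act.
Qed.

Lemma ebar_equiv : equivariant ebar.
Proof. by apply: malg_equivariant => k s; rewrite /= !ebar_bas. Qed.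

Definition cone_map n : {linear malg (N n) F -> malg (N n.+1) F} :=
  mext (fun s => bas (cons1 s)).

Lemma cone_map_bas n s : cone_map n (bas s) = bas (cons1 s).
Proof. exact: mext_bas. Qed.

Lemma dbar_cone n (x : bar_mod n.+1) :
  dbar n.+1 (cone_map _ x) = x - cone_map _ (dbar n x).
Proof.
apply: (eq_malg_linear (f := dbar n.+1 \o cone_map n.+2)
  (g := idfun \- (cone_map n.+1 \o dbar n))) => s /=.
rewrite cone_map_bas !dbar_bas big_ord_recl expr0 scale1r face1_cons1.
congr (_ + _); rewrite (linear_sum (cone_map n.+1)) -sumrN; apply: eq_bigr => i _.
rewrite lift0 linearZ /= cone_map_bas faceSS_cons1.
by rewrite exprS mulN1r scaleNr.
Qed.

Lemma dbar0_cone (x : bar_mod 0) :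
  dbar 0 (cone_map _ x) = x - ebar x *: bas (cons1 [ffun=> 1%g]).
Proof.
pose e : bar_mod 0 := bas (cons1 [ffun=> 1%g]).
have lin : linear (fun y : bar_mod 0 => y - ebar y *: e).
  by move=> a y z; rewrite linearP scalerDl -scalerA scalerBr opprD addrACA.
pose g : {linear bar_mod 0 -> bar_mod 0} := mk_linear lin.
apply: (eq_malg_linear (f := dbar 0 \o cone_map 1) (g := g)) => s.
rewrite /= cone_map_bas dbar_bas /= ebar_bas.
rewrite big_ord_recl big_ord1 face1_cons1 face2_cons1 expr0 expr1 !scale1r.
by rewrite scaleN1r.
Qed.

Lemma ebarK x : ebar (dbar 0 x) = 0.
Proof.
suff H s : ebar (dbar 0 (bas s)) = 0.
  exact: (eq_malg_linear (f := ebar \o dbar 0) (g := \0 : {linear _ -> F^o})).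
rewrite dbar_bas big_ord_recl big_ord1 expr0 expr1 scale1r scaleN1r.
by rewrite linearB !ebar_bas subrr.
Qed.

Lemma dbar_act n k x : dbar n (malg_act F (@bar_act n.+1) k x) =
  malg_act F (@bar_act n) k (dbar n x).
Proof. exact: dbar_equiv. Qed.

(** Every simplex is a translate of a cone, and on a cone the contraction formula gives d d (cone t)
    = cone (d d t). Induction on the degree replaces the double sum of faces. *)
Lemma dbarK_bas n (s : N n.+3) : dbar n (dbar n.+1 (bas s)) = 0.
Proof.
elim: n s => [|n IH] s; rewrite -(bar_act_cons1 s);
  rewrite -(malg_act_bas F (@bar_act _)) dbar_act -cone_map_bas dbar_cone;
  rewrite dbar_act; set t := nerve_face 0 s;
  rewrite -[RHS](linear0 (malg_act F (@bar_act _) (s ord0)));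
  congr (malg_act _ _ _ _); rewrite linearB.
  by rewrite dbar0_cone ebarK scale0r subr0 subrr.
by rewrite dbar_cone IH linear0 subr0 subrr.
Qed.

Lemma dbarK n x : dbar n (dbar n.+1 x) = 0.
Proof.
exact: (eq_malg_linear (f := dbar n \o dbar n.+1)
  (g := \0 : {linear _ -> bar_mod n})) (@dbarK_bas n) x.
Qed.

Lemma dbar_exact n x : dbar n x = 0 -> exists y, dbar n.+1 y = x.
Proof.
by move=> x0; exists (cone_map _ x); rewrite dbar_cone x0 linear0 subr0.
Qed.

Lemma ebar_exact x : ebar x = 0 -> exists y, dbar 0 y = x.
Proof.
by move=> x0; exists (cone_map _ x); rewrite dbar0_cone x0 scale0r subr0.
Qed.

Lemma ebar_surj a : exists x, ebar x = a.
Proof.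
exists (a *: bas (cons1 [ffun=> 1%g])).
by rewrite linearZ ebar_bas; exact: mulr1.
Qed.

Lemma bar_lift n : lifting (bar_mod n).
Proof.
exact: (@malg_lifting F K _ (@bar_act n) (fun s => s ord0) (@bar_act1 n)
  (@bar_actM n) (@bar_act_ord0 n)).
Qed.

Definition bar_resolution : resolution F K :=
  Resolution dbar_equiv ebar_equiv ebar_surj dbarK ebarK dbar_exact ebar_exact
    bar_lift.

Definition bar_coinv n : lmodType F := chains F (BG K) n.

Definition bar_proj n : {linear bar_mod n -> bar_coinv n} :=
  mext (fun s => bas (nerve_face 0 s)).

Definition bar_sec n : {linear bar_coinv n -> bar_mod n} := cone_map n.

Lemma bar_proj_bas n s :
  bar_proj n (bas s) = (bas (nerve_face 0 s) : malg (N n) F).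
Proof. exact: mext_bas. Qed.

Lemma bar_secK n x : bar_proj n (bar_sec n x) = x.
Proof.
apply: (eq_malg_linear (f := bar_proj n \o bar_sec n) (g := idfun)) => s.
by rewrite [LHS]/= cone_map_bas bar_proj_bas face0_cons1.
Qed.

Lemma bar_proj_act n k x : bar_proj n (gact k x) = bar_proj n x.
Proof.
apply: (eq_malg_linear (f := bar_proj n \o malg_act F (@bar_act n) k)) => s.
by rewrite [LHS]/= malg_act_bas !bar_proj_bas face0_act.
Qed.

Lemma bar_univ n (M : lmodType F) (phi : {linear bar_mod n -> M}) :
  (forall k x, phi (gact k x) = phi x) ->
  forall x, phi (bar_sec n (bar_proj n x)) = phi x.
Proof.
move=> inv x.
apply: (eq_malg_linear (f := phi \o (bar_sec n \o bar_proj n))) => s.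
rewrite [LHS]/= bar_proj_bas [bar_sec _ _]cone_map_bas.
by rewrite -[in RHS](bar_act_cons1 s) -(malg_act_bas F (@bar_act n)) [RHS]inv.
Qed.

Definition bar_dcoinv n : {linear bar_coinv n.+1 -> bar_coinv n} :=
  mext (fun s : N n.+1 =>
    \sum_(i < n.+2) (-1) ^+ i *: (bas (nerve_face i s) : malg (N n) F)).

Lemma bar_dcoinvE n x :
  bar_dcoinv n (bar_proj n.+1 x) = bar_proj n (dbar n x).
Proof.
apply: (eq_malg_linear (f := bar_dcoinv n \o bar_proj n.+1)
  (g := bar_proj n \o dbar n)) => s.
rewrite [LHS]/= [RHS]/= bar_proj_bas dbar_bas linear_sum [LHS]mext_bas.
apply: eq_bigr => i _; rewrite linearZ; congr (_ *: _).
rewrite [RHS]bar_proj_bas; congr bas; symmetry.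
(* Moving face 0 past face i + 1 turns the latter into face i; thus the differential upstairs
   induces the full boundary of the nerve. *)
by apply: (@nerve_faceC K n 0 i.+1); rewrite ltn_ord.
Qed.

Definition bar_coinvariants : coinvariants bar_resolution :=
  @Coinvariants _ _ bar_resolution bar_coinv bar_proj bar_sec bar_secK
    bar_proj_act bar_univ bar_dcoinv bar_dcoinvE.

Lemma bettiE (R : realType) n : betti R F (BG K) n =
  quotient_dim R (@cocycle _ _ _ bar_coinvariants n)
    (@coboundary _ _ _ bar_coinvariants n).
Proof. by case: n. Qed.

End BarResolution.

(** * The Salvetti resolution and its coinvariants *)

Section GradedKoszul.
Variables (F : fieldType) (V : finType) (L : simplicial_complex V).

Definition kset n : finType := {s : {set V} | iclique L n finset.setT s}.

Section Graded.
Variables (M : lmodType F) (T : V -> {linear M -> M}).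
Implicit Types (s : {set V}).

(** With [krestr], it passes between the families indexed by cliques, on which dimensions make
    sense, and the functions on all sets used for exactness. *)
Definition ext0 n (c : {ffun kset n -> M}) s : M :=
  if insub s is Some t then c t else 0.

Definition krestr n (b : {set V} -> M) : {ffun kset n -> M} :=
  [ffun t => b (val t)].

Lemma ext0_val n (c : {ffun kset n -> M}) t : ext0 c (val t) = c t.
Proof. by rewrite /ext0 valK. Qed.

Lemma supported_ext0 n (c : {ffun kset n -> M}) :
  supported L n finset.setT (ext0 c).
Proof. by move=> s ns; rewrite /ext0 insubN. Qed.

Lemma ext0_res n b s : supported L n finset.setT b -> ext0 (krestr n b) s = b s.
Proof.
move=> bn; rewrite /ext0; case: insubP => [t _ <-|ns]; first by rewrite ffunE.
by rewrite bn.
Qed.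

Lemma ext0_linear n a (c c' : {ffun kset n -> M}) s :
  ext0 (a *: c + c') s = a *: ext0 c s + ext0 c' s.
Proof.
rewrite /ext0; case: insub => [t|]; first by rewrite !ffunE.
by rewrite scaler0 addr0.
Qed.

Definition dkoszul n (c : {ffun kset n.+1 -> M}) : {ffun kset n -> M} :=
  krestr n (koszul T (ext0 c)).

Lemma dkoszul_linear n : linear (@dkoszul n).
Proof.
move=> a c c'; apply/ffunP => t; rewrite !ffunE -koszulZ -koszulD.
by apply: eq_koszul => s; exact: ext0_linear.
Qed.

HB.instance Definition _ n :=
  GRing.isLinear.Build F {ffun kset n.+1 -> M} {ffun kset n -> M} _
    (@dkoszul n) (@dkoszul_linear n).

Lemma ext0_dkoszul n c s : ext0 (@dkoszul n c) s = koszul T (ext0 c) s.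
Proof.
by apply: ext0_res; apply: supported_koszul; exact: supported_ext0.
Qed.

Lemma dkoszulK n c :
  (forall u v m, adjacent L u v -> T u (T v m) = T v (T u m)) ->
  @dkoszul n (@dkoszul n.+1 c) = 0.
Proof.
move=> TC; apply/ffunP => t; rewrite !ffunE.
rewrite (@eq_koszul _ _ _ _ _ (koszul T (ext0 c))); last exact: ext0_dkoszul.
by apply: (koszul_koszul TC); exact: supported_ext0.
Qed.

End Graded.

Lemma dkoszul_nat (M N : lmodType F) (T : V -> {linear M -> M})
    (T' : V -> {linear N -> N}) (p : {linear M -> N}) n c :
  (forall v x, p (T v x) = T' v (p x)) ->
  ffun_map p (dkoszul T c) = dkoszul T' (ffun_map p c) :> {ffun kset n -> N}.
Proof.
move=> pT; apply/ffunP => t; rewrite !ffunE linear_sum.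
apply: eq_bigr => v _; rewrite linearZ /= pT; congr (_ *: T' v _).
rewrite /ext0; case: insub => [s|]; last exact: linear0.
by rewrite ffunE.
Qed.

End GradedKoszul.

Section Salvetti.
Variables (F : fieldType) (V : finType) (L : simplicial_complex V).
Variables (K : groupType) (iota : K -> raag L) (X : finType).
Variables (cX : raag L -> X) (rX : X -> raag L).
Hypothesis iota1 : iota 1%g = 1%g.
Hypothesis iotaM : forall k l, iota (k * l)%g = (iota k * iota l)%g.
Hypothesis iota_inj : injective iota.
Hypothesis cX_iota : forall k g, cX (iota k * g)%g = cX g.
Hypothesis cX_inv : forall g h, cX g = cX h -> exists k, g = (iota k * h)%g.
Hypothesis rXK : cancel rX cX.
Local Notation A := (malg (raag L) F).
Local Notation kset := (kset L).

(** K is only embedded by [iota], since a subgroup of H is not literally one of Gamma; [cX] and [rX]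
    present the finite set K\Gamma. K acts on the left, so right multiplication remains for the
    differential. *)
Definition lact k (g : raag L) := (iota k * g)%g.

Lemma lact1 g : lact 1%g g = g.
Proof. by rewrite /lact iota1 mul1g. Qed.

Lemma lactM k l g : lact (k * l)%g g = lact k (lact l g).
Proof. by rewrite /lact iotaM mulgA. Qed.

Definition gring : gmod F K := malg_gmod F lact1 lactM.

Lemma transversal g : exists k, g = lact k (rX (cX g)).
Proof. by apply: cX_inv; rewrite rXK. Qed.

Lemma gring_lifting : lifting gring.
Proof.
have [rep repE] := choice transversal.
apply: (@malg_lifting F K _ lact rep) => k g.
apply: iota_inj; apply: (@mulIg _ (rX (cX g))).
transitivity (lact k g); last by rewrite {1}(repE g) /lact iotaM mulgA.
by rewrite [RHS]repE {4}/lact cX_iota.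
Qed.

Definition sal_mod n : gmod F K := ffun_gmod gring (kset n).

Definition sal_T v : {linear A -> A} := gen_diff v.

Definition dsal n : {linear sal_mod n.+1 -> sal_mod n} := dkoszul sal_T (n := n).

Lemma dsal_equiv n : equivariant (dsal n).
Proof.
move=> k x; symmetry; apply: (dkoszul_nat (p := malg_act F lact k)) => v y.
suff H g : malg_act F lact k (gen_diff v (bas g)) =
    gen_diff v (malg_act F lact k (bas g)).
  exact: (eq_malg_linear (f := malg_act F lact k \o sal_T v)
    (g := sal_T v \o malg_act F lact k)) H y.
rewrite malg_act_bas /gen_diff !rmul_bas linearB !malg_act_bas.
by rewrite /lact mulgA.
Qed.

Definition esal_fun (c : sal_mod 0) : F^o := augm (ext0 c finset.set0).

Lemma esal_linear : linear esal_fun.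
Proof. by move=> a c c'; rewrite /esal_fun ext0_linear /augm linearP. Qed.

Definition esal : {linear sal_mod 0 -> triv_gmod F K} := mk_linear esal_linear.

Lemma esalE c : esal c = augm (ext0 c finset.set0). Proof. by []. Qed.

Lemma esal_equiv : equivariant esal.
Proof.
move=> k c; rewrite [RHS]/= !esalE.
have -> : ext0 (gact k c) finset.set0 = malg_act F lact k (ext0 c finset.set0).
  by rewrite /ext0; case: insub => [t|]; rewrite ?linear0// ffunE.
apply: (eq_malg_linear (f := mext (fun=> 1 : F^o) \o malg_act F lact k)
  (g := mext (fun=> 1 : F^o))) => g.
have e : augm (malg_act F lact k (bas g)) = augm (bas g).
  by rewrite malg_act_bas /augm !mext_bas.
exact: e.
Qed.

Lemma iclique0 s : iclique L 0 finset.setT s = (s == finset.set0).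
Proof.
rewrite /iclique cards_eq0 subsetT andbT.
by case: eqP => [->|]; rewrite ?andbF// andbT; apply/cliqueP => u v; rewrite inE.
Qed.

Lemma esal_surj a : exists x, esal x = a.
Proof.
exists (krestr L 0 (fun s => if s == finset.set0 then a *: (bas 1%g : A) else 0)).
rewrite esalE ext0_res ?eqxx; last by move=> s; rewrite iclique0 => /negbTE ->.
by rewrite /augm linearZ /= mext_bas; exact: mulr1.
Qed.

Lemma dsalK n x : dsal n (dsal n.+1 x) = 0.
Proof. by apply: dkoszulK => u v m; exact: gen_diffC. Qed.

Lemma augm_gen_diff v (x : A) : augm (gen_diff v x) = 0.
Proof.
rewrite /augm mext_gen_diff -[RHS](mext0 F^o x).
by apply: (@eq_mext F (raag L) F^o) => g; rewrite subrr.
Qed.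

Lemma esalK x : esal (dsal 0 x) = 0.
Proof.
rewrite esalE ext0_dkoszul /augm linear_sum; apply: big1 => v _.
rewrite linearZ; transitivity (inc_sign F v finset.set0 *: (0 : F^o)).
  by congr (_ *: _); exact: augm_gen_diff.
exact: mulr0.
Qed.

Lemma dsal_exact n x : dsal n x = 0 -> exists y, dsal n.+1 y = x.
Proof.
move=> x0; have [|b bn bE] := koszul_exact (supported_ext0 (L := L) x).
  move=> s; rewrite -(ext0_dkoszul sal_T) [dkoszul _ _]x0 /ext0.
  by case: insub => // t; rewrite ffunE.
exists (krestr L n.+2 b); apply/ffunP => t; rewrite ffunE -ext0_val -bE.
by apply: eq_koszul => s; rewrite ext0_res.
Qed.

Lemma esal_exact x : esal x = 0 -> exists y, dsal 0 y = x.
Proof.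
move=> x0; have [b bn bE] := koszul_augm_exact x0.
exists (krestr L 1 b); apply/ffunP => t; rewrite ffunE -ext0_val.
have /eqP -> : val t == finset.set0 by rewrite -iclique0; exact: valP.
by rewrite -bE; apply: eq_koszul => s; rewrite ext0_res.
Qed.

Lemma sal_lift n : lifting (sal_mod n).
Proof. by apply: ffun_lifting; exact: gring_lifting. Qed.

Definition sal_resolution : resolution F K :=
  Resolution dsal_equiv esal_equiv esal_surj dsalK esalK dsal_exact esal_exact
    sal_lift.

Definition mvX g q : X := cX (rX q * g)%g.

Lemma cXM g h : cX (g * h)%g = mvX h (cX g).
Proof. by have [k ->] := transversal g; rewrite /mvX /lact -mulgA !cX_iota rXK. Qed.

Lemma mvXM g h q : mvX h (mvX g q) = mvX (g * h)%g q.
Proof. by rewrite -[q]rXK -!cXM mulgA. Qed.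

Lemma mvX1 q : mvX 1%g q = q.
Proof. by rewrite /mvX mulg1 rXK. Qed.

Lemma mvXK g : cancel (mvX g) (mvX g^-1%g).
Proof. by move=> q; rewrite mvXM mulgV mvX1. Qed.

Lemma mvVXK g : cancel (mvX g^-1%g) (mvX g).
Proof. by move=> q; rewrite mvXM mulVg mvX1. Qed.

Local Notation FX := {ffun X -> F^o}.

(** Right multiplication by g_v minus the identity on F[K\Gamma]. The inverse appears because
    elements are written as functions on cosets: the point mass at q moves to q g_v. *)
Definition cosal_T_fun v (f : FX) : FX :=
  [ffun q => f (mvX (gen L v)^-1%g q) - f q].

Lemma cosal_T_linear v : linear (cosal_T_fun v).
Proof.
move=> a f f'; apply/ffunP => q; rewrite !ffunE scalerBr opprD.
by rewrite addrACA.
Qed.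

Definition cosal_T v : {linear FX -> FX} := mk_linear (@cosal_T_linear v).

Lemma cosal_TE v f q : cosal_T v f q = f (mvX (gen L v)^-1%g q) - f q.
Proof. by rewrite [LHS]ffunE. Qed.

Definition dirac q : FX := [ffun q' => (q' == q)%:R].

Definition pX : {linear A -> FX} := mext (fun g => dirac (cX g)).

Lemma pX_bas g : pX (bas g) = dirac (cX g).
Proof. exact: mext_bas. Qed.

Definition sX_fun (f : FX) : A := \sum_q f q *: bas (rX q).

Lemma sX_linear : linear sX_fun.
Proof.
move=> a f f'; rewrite /sX_fun scaler_sumr -big_split; apply: eq_bigr => q _.
by rewrite !ffunE scalerDl scalerA.
Qed.

Definition sX : {linear FX -> A} := mk_linear sX_linear.

Lemma sX_dirac q : sX (dirac q) = bas (rX q).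
Proof.
rewrite [LHS](bigD1 q)//= ffunE eqxx scale1r big1 ?addr0// => q' qq'.
by rewrite ffunE (negbTE qq') scale0r.
Qed.

Lemma pXK f : pX (sX f) = f.
Proof.
apply/ffunP => q; rewrite [sX f]/(sX_fun f) linear_sum sum_ffunE.
have H q' : pX (f q' *: bas (rX q')) q = f q' * (q == q')%:R.
  by rewrite linearZ pX_bas rXK !ffunE.
transitivity (\sum_q' f q' * (q == q')%:R); first exact: eq_bigr.
rewrite (bigD1 q)//= eqxx mulr1 big1 ?addr0// => q' qq'.
by rewrite eq_sym (negbTE qq') mulr0.
Qed.

Lemma pX_T v x : pX (sal_T v x) = cosal_T v (pX x).
Proof.
apply: (eq_malg_linear (f := pX \o sal_T v) (g := cosal_T v \o pX)) => g.
rewrite [LHS]/= [RHS]/= /gen_diff rmul_bas linearB !pX_bas.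
apply/ffunP => q; rewrite cosal_TE !ffunE cXM; congr (_%:R - _).
by rewrite -(can2_eq (mvVXK _) (mvXK _)).
Qed.

Definition sal_coinv n : lmodType F := {ffun kset n -> FX}.

Definition sal_proj n : {linear sal_mod n -> sal_coinv n} := ffun_map pX.

Definition sal_sec n : {linear sal_coinv n -> sal_mod n} := ffun_map sX.

Definition sal_dcoinv n : {linear sal_coinv n.+1 -> sal_coinv n} :=
  dkoszul cosal_T (n := n).

Lemma sal_secK n x : sal_proj n (sal_sec n x) = x.
Proof. by apply/ffunP => t; rewrite !ffunE pXK. Qed.

Lemma pX_act k x : pX (malg_act F lact k x) = pX x.
Proof.
apply: (eq_malg_linear (f := pX \o malg_act F lact k)) => g.
by rewrite [LHS]/= malg_act_bas !pX_bas cX_iota.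
Qed.

Lemma sal_proj_act n k x : sal_proj n (gact k x) = sal_proj n x.
Proof. by apply/ffunP => t; rewrite !ffunE [LHS]pX_act. Qed.

Lemma sal_univ n (M : lmodType F) (phi : {linear sal_mod n -> M}) :
  (forall k x, phi (gact k x) = phi x) ->
  forall x, phi (sal_sec n (sal_proj n x)) = phi x.
Proof.
move=> inv x; rewrite (ffun_decomp x) !linear_sum; apply: eq_bigr => t _.
have -> : sal_sec n (sal_proj n (ffun_inj t (x t))) = ffun_inj t (sX (pX (x t))).
  by apply/ffunP => u; rewrite !ffunE; case: eqP => // _; rewrite !linear0.
pose psi : {linear A -> M} := phi \o @ffun_inj F (kset n) A t.
suff H g : psi (sX (pX (bas g))) = psi (bas g).
  exact: (eq_malg_linear (f := psi \o (sX \o pX)) (g := psi)) H (x t).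
have [k gE] := transversal g.
rewrite pX_bas sX_dirac [in RHS]gE -(malg_act_bas F lact) /psi /= -(inv k).
congr (phi _); apply/ffunP => u; rewrite !ffunE; case: eqP => // _.
exact: linear0.
Qed.

Lemma sal_dcoinvE n x :
  sal_dcoinv n (sal_proj n.+1 x) = sal_proj n (dsal n x).
Proof. by symmetry; apply: dkoszul_nat; exact: pX_T. Qed.

Definition sal_coinvariants : coinvariants sal_resolution :=
  @Coinvariants _ _ sal_resolution sal_coinv sal_proj sal_sec sal_secK
    sal_proj_act sal_univ sal_dcoinv sal_dcoinvE.

Lemma betti_salvetti (R : realType) n : betti R F (BG K) n =
  quotient_dim R (@cocycle _ _ _ sal_coinvariants n)
    (@coboundary _ _ _ sal_coinvariants n).
Proof. by rewrite bettiE; exact: quotient_dim_coinv. Qed.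

End Salvetti.

(** * Rank estimates *)

Section FiniteDimension.
Variable F : fieldType.

Lemma quotient_dim_vspace (R : realType) (C : vectType F) (Z B : {vspace C}) :
  (B <= Z)%VS ->
  quotient_dim R [set x : C | x \in Z]%classic [set x : C | x \in B]%classic =
  (\dim Z - \dim B)%N%:R%:E.
Proof.
move=> BZ; apply/eqP; rewrite eq_le; apply/andP; split.
  apply: ge_ereal_sup => _ [n [e eZ ind] <-]; rewrite lee_fin ler_nat.
  pose X := [tuple e i | i < n].
  have sumX (a : 'I_n -> F) : \sum_(i < n) a i *: X`_i = \sum_(j < n) a j *: e j.
    by apply: eq_bigr => i _; rewrite -tnth_nth tnth_mktuple.
  have freeX : free X.
    apply/freeP => a; rewrite sumX => a0; apply: ind.
    by rewrite a0 /= mem0v.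
  have XB0 : (<<X>> :&: B = 0)%VS.
    apply/eqP; rewrite -subv0; apply/subvP => x /memv_capP[xX xB].
    rewrite (coord_span xX) big1 ?mem0v// => i _.
    rewrite (ind (fun i => coord X i x)) ?scale0r//.
    by rewrite -sumX -coord_span.
  have XZ : (<<X>> + B <= Z)%VS.
    rewrite subv_add BZ andbT; apply/span_subvP => x /tnthP[i ->].
    by rewrite tnth_mktuple; exact: eZ.
  have := dimvS XZ; rewrite dimv_disjoint_sum//.
  by rewrite (eqP freeX) size_tuple leq_subRL ?dimvS// addnC.
apply: ereal_sup_ubound; exists (\dim Z - \dim B)%N => //.
have dimD : \dim (Z :\: B) = (\dim Z - \dim B)%N.
  by rewrite -(dimv_cap_compl Z B) (capv_idPr BZ) addKn.
rewrite -dimD; set X := vbasis (Z :\: B).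
exists (fun j => X`_j) => [j|a aB] /=.
  apply: (subvP (diffvSl Z B)); apply: vbasis_mem.
  by apply: mem_nth; rewrite size_tuple.
have /freeP : free X by exact: basis_free (vbasisP _).
apply; apply/eqP; rewrite -memv0 -(capv_diff Z B); apply/memv_capP; split => //.
apply: memv_suml => j _; apply: memvZ; apply: vbasis_mem.
by apply: mem_nth; rewrite size_tuple.
Qed.

Lemma lker_comp_dim (U V W : vectType F) (f : 'Hom(V, W)) (g : 'Hom(U, V)) :
  (\dim (lker (f \o g)) <= \dim (lker g) + \dim (lker f))%N.
Proof.
rewrite -(limg_ker_dim g (lker (f \o g))) leq_add//; apply: dimvS.
  exact: capvSr.
apply/subvP => _ /memv_imgP[x xk ->]; move: xk.
by rewrite !memv_ker comp_lfunE.
Qed.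

Section RankComparison.
Variables (C1 C0 D1 D0 : vectType F).
Variables (d : 'Hom(C1, C0)) (d' : 'Hom(D1, D0)).
Variables (f1 : 'Hom(C1, D1)) (f0 : 'Hom(C0, D0)).
Hypothesis fd : (f0 \o d = d' \o f1)%VF.

Lemma rank_le_source : (\dim (limg d) <= \dim (limg d') + \dim (lker f0))%N.
Proof.
rewrite -(limg_ker_dim f0 (limg d)) addnC leq_add//; last first.
  by apply: dimvS; exact: capvSr.
by rewrite -limg_comp fd limg_comp; apply: dimvS; apply: limgS; exact: subvf.
Qed.

(** Restricting d' to the image of f1 costs at most the codimension of that image, which is the
    dimension of the kernel of f1 when source and target have equal dimension. *)
Lemma rank_le_target : \dim {:C1} = \dim {:D1} ->
  (\dim (limg d') <= \dim (limg d) + \dim (lker f1))%N.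
Proof.
move=> dimE; rewrite -(addv_complf (limg f1)) limgD.
apply: leq_trans (dimv_add_leqif _ _) _; apply: leq_add.
  by rewrite -limg_comp -fd limg_comp -[leqRHS](limg_ker_dim f0) leq_addl.
rewrite -[leqLHS]add0n.
have h := limg_ker_dim d' (limg f1)^C; apply: (@leq_trans (\dim (limg f1)^C)).
  by rewrite -h leq_addl.
rewrite dimv_compl -dimE -(limg_ker_dim f1 fullv) capfv.
by rewrite addnK.
Qed.

End RankComparison.

End FiniteDimension.

(** * Comparison with the complex whose operators are all the identity *)

Section KoszulDimension.
Variables (F : fieldType) (V : finType) (L : simplicial_complex V).
Variables (M : vectType F) (T : V -> {linear M -> M}).
Local Notation kset := (kset L).
Implicit Types (s : {set V}) (r : seq V).

(** The list fixes the order of the product, since operators at non-adjacent vertices need not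
    commute; within a clique the order is immaterial. *)
Definition compose_on s r (m : M) : M :=
  foldr (fun v m => if v \in s then T v m else m) m r.

Lemma compose_on_linear s r : linear (compose_on s r).
Proof.
elim: r => [|v r IH] a x y //=.
by rewrite /compose_on /= -!/(compose_on _ _ _) IH; case: ifP => // _; exact: linearP.
Qed.

HB.instance Definition _ s r :=
  GRing.isLinear.Build F M M _ (compose_on s r) (compose_on_linear s r).

Lemma compose_on_lker s r :
  (\dim (lker (linfun (compose_on s r))) <=
   \sum_(v <- r) \dim (lker (linfun (T v))))%N.
Proof.
elim: r => [|v r IH].
  rewrite big_nil leqn0 dimv_eq0; apply/lker0P => x y.
  by rewrite !lfunE.
rewrite big_cons; case vs : (v \in s); last first.
  apply: leq_trans (leq_addl _ _); apply: leq_trans IH.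
  apply: dimvS; apply/subvP => x; rewrite !memv_ker !lfunE.
  by rewrite /compose_on /= vs.
have -> : linfun (compose_on s (v :: r)) =
    (linfun (T v) \o linfun (compose_on s r))%VF.
  by apply/lfunP => x; rewrite comp_lfunE !lfunE /compose_on /= vs.
apply: leq_trans (lker_comp_dim _ _) _.
by rewrite addnC leq_add2l.
Qed.

Hypothesis TC : forall u v m, adjacent L u v -> T u (T v m) = T v (T u m).

Lemma compose_onC s r v m : clique L s -> v \in s -> v \notin r ->
  compose_on s r (T v m) = T v (compose_on s r m).
Proof.
move=> /cliqueP sc vs; elim: r => //= u r IH.
rewrite inE negb_or => /andP[vu vr]; rewrite /compose_on /= -!/(compose_on _ _ _).
rewrite IH//; case: ifP => // us; rewrite TC//.
by apply: sc => //; rewrite eq_sym.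
Qed.

Lemma compose_onD1 s r v m : v \notin r ->
  compose_on (s :\ v)%SET r m = compose_on s r m.
Proof.
elim: r => //= u r IH; rewrite inE negb_or => /andP[vu vr].
rewrite /compose_on /= -!/(compose_on _ _ _) IH// !inE eq_sym (negbTE vu).
by [].
Qed.

Definition compose_all s : {linear M -> M} := compose_on s (enum V).

Lemma compose_allU1 s v m : clique L (v |: s)%SET -> v \notin s ->
  compose_all (v |: s)%SET m = compose_all s (T v m).
Proof.
move=> sc vs; rewrite /compose_all /=.
have ven : v \in enum V by rewrite mem_enum.
have uniqV := enum_uniq V.
rewrite -[in RHS](setU1K vs); set s' := (v |: s)%SET.
have vs' : v \in s' by exact: setU11.
move: uniqV; case/splitPr: ven => r1 r2.
rewrite cat_uniq /= negb_or => /and3P[_ /andP[vr1 _] /andP[vr2 _]].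
rewrite /compose_on !foldr_cat /= vs' setD11 -!/(compose_on _ _ _).
rewrite !compose_onD1//; congr (compose_on _ _ _).
by rewrite compose_onC.
Qed.

Definition id_T (v : V) : {linear M -> M} := idfun.

(** A chain map from the complex of the T_v to that of identities: the factor T_v in the
    differential is what distinguishes the product over t from the product over t with v added. *)
Definition kos_map n (c : {ffun kset n -> M}) : {ffun kset n -> M} :=
  [ffun t => compose_all (val t) (c t)].

Lemma kos_map_linear n : linear (@kos_map n).
Proof. by move=> a c c'; apply/ffunP => t; rewrite !ffunE linearP. Qed.

HB.instance Definition _ n :=
  GRing.isLinear.Build F {ffun kset n -> M} {ffun kset n -> M} _
    (@kos_map n) (@kos_map_linear n).

Lemma kos_map_d n (c : {ffun kset n.+1 -> M}) :
  kos_map (dkoszul T c) = dkoszul id_T (kos_map c).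
Proof.
apply/ffunP => t; rewrite !ffunE linear_sum; apply: eq_bigr => v vt.
rewrite linearZ; congr (_ *: _); rewrite /ext0; case: insubP => [t' _ t'E|_].
  rewrite ffunE /= t'E compose_allU1// -t'E.
  by case/and3P: (valP t').
by rewrite !linear0.
Qed.

(** It measures how far the operators are from being invertible; every rank comparison is exact up
    to a multiple of it. *)
Definition kernel_defect : nat := \sum_v \dim (lker (linfun (T v))).

Lemma kos_map_lker n :
  (\dim (lker (linfun (@kos_map n))) <= #|kset n| * kernel_defect)%N.
Proof.
pose W (t : kset n) := (linfun (@ffun_inj F (kset n) M t) @:
  lker (linfun (compose_all (val t))))%VS.
have sub : (lker (linfun (@kos_map n)) <= \sum_t W t)%VS.
  apply/subvP => c; rewrite memv_ker lfunE => /eqP c0.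
  rewrite [c]ffun_decomp; apply: memv_sumr => t _.
  rewrite -(lfunE (@ffun_inj F (kset n) M t)); apply: memv_img.
  by rewrite memv_ker lfunE; have /ffunP/(_ t) := c0; rewrite !ffunE => ->.
apply: leq_trans (dimvS sub) _; apply: leq_trans (dimv_leq_sum _ _ _) _.
rewrite -sum_nat_const; apply: leq_sum => t _.
apply: (@leq_trans (\dim (lker (linfun (compose_all (val t)))))).
  by rewrite -[leqRHS](limg_ker_dim (linfun (@ffun_inj F (kset n) M t))) leq_addl.
apply: leq_trans (compose_on_lker _ _) _.
by rewrite /kernel_defect big_enum.
Qed.

Definition krank n := \dim (limg (linfun (@dkoszul F V L M T n))).
Definition krank_id n := \dim (limg (linfun (@dkoszul F V L M id_T n))).

Lemma kos_map_comp n :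
  (linfun (@kos_map n) \o linfun (@dkoszul F V L M T n) =
   linfun (@dkoszul F V L M id_T n) \o linfun (@kos_map n.+1))%VF.
Proof. by apply/lfunP => c; rewrite !comp_lfunE !lfunE; exact: kos_map_d. Qed.

Lemma krank_le n :
  (krank n <= krank_id n + #|kset n| * kernel_defect)%N.
Proof.
apply: leq_trans (rank_le_source (kos_map_comp n)) _.
by rewrite leq_add2l kos_map_lker.
Qed.

Lemma krank_id_le n :
  (krank_id n <= krank n + #|kset n.+1| * kernel_defect)%N.
Proof.
apply: leq_trans (rank_le_target (kos_map_comp n) _) _ => //.
by rewrite leq_add2l kos_map_lker.
Qed.

End KoszulDimension.

Section IdRank.
Variables (F : fieldType) (V : finType) (L : simplicial_complex V).
Variable (X : finType).
Local Notation kset := (kset L).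
Local Notation FX := {ffun X -> F^o}.

Let spread n q : {linear {ffun kset n -> F^o} -> {ffun kset n -> FX}} :=
  ffun_map (@ffun_inj F X F^o q).

Lemma ev_linear q : linear (fun f : FX => f q : F^o).
Proof. by move=> a f g; rewrite !ffunE. Qed.

Let ev q : {linear FX -> F^o} := mk_linear (ev_linear q).

Let evs n q : {linear {ffun kset n -> FX} -> {ffun kset n -> F^o}} :=
  ffun_map (ev q).

Lemma spread_decomp n c : c = \sum_q spread n q (evs n q c).
Proof.
apply/ffunP => t; rewrite sum_ffunE [c t]ffun_decomp; apply: eq_bigr => q _.
by rewrite !ffunE.
Qed.

Lemma spread_d n q (c : {ffun kset n.+1 -> F^o}) :
  dkoszul (@id_T F V FX) (spread n.+1 q c) =
  spread n q (dkoszul (@id_T F V F^o) c).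
Proof. by symmetry; apply: dkoszul_nat. Qed.

Lemma evs_d n q (c : {ffun kset n.+1 -> FX}) :
  dkoszul (@id_T F V F^o) (evs n.+1 q c) =
  evs n q (dkoszul (@id_T F V FX) c).
Proof. by symmetry; apply: dkoszul_nat. Qed.

Lemma krank_id_ffun n :
  krank_id L FX n = (#|X| * krank_id L (F^o : vectType F) n)%N.
Proof.
pose d := linfun (@dkoszul F V L FX (@id_T _ _ _) n).
pose d1 := linfun (@dkoszul F V L F^o (@id_T _ _ _) n).
have spread_dim m q (U : {vspace {ffun kset m -> F^o}}) :
    (\dim (linfun (spread m q) @: U) <= \dim U)%N.
  by rewrite -[leqRHS](limg_ker_dim (linfun (spread m q))) leq_addl.
have img : (\dim (limg d) <= #|X| * \dim (limg d1))%N.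
  have sub : (limg d <= \sum_q (linfun (spread n q) @: limg d1))%VS.
    apply/subvP => _ /memv_imgP[c _ ->]; rewrite lfunE (spread_decomp c).
    rewrite linear_sum; apply: memv_sumr => q _; rewrite [X in X \in _]spread_d.
    rewrite -(lfunE (spread n q)); apply: memv_img.
    by rewrite -(lfunE (@dkoszul F V L F^o (@id_T _ _ _) n)) memv_img ?memvf.
  apply: leq_trans (dimvS sub) _; apply: leq_trans (dimv_leq_sum _ _ _) _.
  by rewrite -sum_nat_const; apply: leq_sum => q _; exact: spread_dim.
have ker : (\dim (lker d) <= #|X| * \dim (lker d1))%N.
  have sub : (lker d <= \sum_q (linfun (spread n.+1 q) @: lker d1))%VS.
    apply/subvP => c; rewrite memv_ker lfunE => /eqP c0.
    rewrite (spread_decomp c); apply: memv_sumr => q _.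
    rewrite -(lfunE (spread n.+1 q)); apply: memv_img.
    by rewrite memv_ker lfunE [X in X == _]evs_d [dkoszul _ _]c0 linear0.
  apply: leq_trans (dimvS sub) _; apply: leq_trans (dimv_leq_sum _ _ _) _.
  by rewrite -sum_nat_const; apply: leq_sum => q _; exact: spread_dim.
(* The upper bounds for image and kernel add up to the dimension of the whole space, so both are
   equalities. *)
have e := limg_ker_dim d fullv; have e1 := limg_ker_dim d1 fullv.
rewrite !capfv !dimvf in e e1.
have dimE : dim {ffun kset n.+1 -> FX} = (#|X| * dim {ffun kset n.+1 -> F^o})%N.
  transitivity (#|kset n.+1| * (#|X| * 1))%N; first by [].
  by rewrite muln1 mulnC -[in LHS](muln1 #|kset n.+1|).
apply/eqP; rewrite eqn_leq img /=.
rewrite dimE -e1 mulnDr in e.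
by rewrite -(leq_add2l (#|X| * \dim (lker d1))) -e leq_add2r.
Qed.

End IdRank.

Section RankBounds.
Variables (F : fieldType) (V : finType) (L : simplicial_complex V).
Local Notation kset := (kset L).

(** [krank n] belongs to the differential arriving in degree n; the shift gives the one leaving it,
    which is zero in degree 0. *)
Definition before (rk : nat -> nat) n := if n is m.+1 then rk m else 0%N.

Lemma before_krank (M : vectType F) (T : V -> {linear M -> M}) n :
  (forall u v m, adjacent L u v -> T u (T v m) = T v (T u m)) ->
  (before (krank L T) n + krank L T n <= dim {ffun kset n -> M})%N.
Proof.
move=> TC; case: n => [|n].
  by rewrite add0n -dimvf; apply: dimvS; exact: subvf.
rewrite -dimvf -(limg_ker_dim (linfun (@dkoszul F V L M T n)) fullv) capfv.
rewrite addnC leq_add2r; apply: dimvS; apply/subvP => _ /memv_imgP[c _ ->].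
by rewrite memv_ker !lfunE; apply/eqP; exact: dkoszulK.
Qed.

(* For a flag complex L, this is the dimension of the reduced homology of L *)
(* in degree n - 1: a clique with n vertices is a simplex of dimension n - 1. *)
Definition clique_betti n : nat :=
  #|kset n| - (before (krank_id L (F^o : vectType F)) n +
               krank_id L (F^o : vectType F) n).

Lemma clique_bettiE n :
  (clique_betti n + (before (krank_id L (F^o : vectType F)) n +
     krank_id L (F^o : vectType F) n) = #|kset n|)%N.
Proof.
rewrite subnK//; have := @before_krank F^o (@id_T F V F^o) n.
have -> : dim {ffun kset n -> F^o} = #|kset n| by exact: muln1.
exact.
Qed.

(** The rank arriving in degree n is known up to the cliques of sizes n and n + 1 for its two
    inequalities, the rank leaving it up to those of sizes n - 1 and n. Their sum serves both
    directions. *)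
Definition clique_error n : nat :=
  #|kset n.-1| + 2 * #|kset n| + #|kset n.+1|.

End RankBounds.

Section SalvettiBounds.
Variables (F : fieldType) (V : finType) (L : simplicial_complex V).
Variables (K : groupType) (iota : K -> raag L) (X : finType).
Variables (cX : raag L -> X) (rX : X -> raag L).
Hypothesis iota1 : iota 1%g = 1%g.
Hypothesis iotaM : forall k l, iota (k * l)%g = (iota k * iota l)%g.
Hypothesis iota_inj : injective iota.
Hypothesis cX_iota : forall k g, cX (iota k * g)%g = cX g.
Hypothesis cX_inv : forall g h, cX g = cX h -> exists k, g = (iota k * h)%g.
Hypothesis rXK : cancel rX cX.
Local Notation kset := (kset L).
Local Notation FX := {ffun X -> F^o}.
Local Notation T := (cosal_T F cX rX).
Local Notation mv := (mvX cX rX).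

(** The projection [pX] is onto and intertwines these operators with those on the group ring, where
    commutation is known. *)
Lemma cosal_TC u v (f : FX) : adjacent L u v -> T u (T v f) = T v (T u f).
Proof.
move=> uv; have e := pX_T (F := F) cX_iota cX_inv rXK.
rewrite -(pXK rXK f); move: (sX F rX f) => y.
have e2 w1 w2 : T w1 (T w2 (pX F cX y)) =
    pX F cX (gen_diff w1 (gen_diff w2 y)).
  exact: (etrans (congr1 (T w1) (esym (e w2 y))) (esym (e w1 _))).
have e3 := congr1 (pX F cX) (gen_diffC y uv).
exact: (etrans (e2 u v) (etrans e3 (esym (e2 v u)))).
Qed.

Lemma betti_rank (R : realType) n : exists2 b : nat,
  betti R F (BG K) n = b%:R%:E &
  (b + (before (krank L T) n + krank L T n) = #|kset n| * #|X|)%N.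
Proof.
have rkn := before_krank n cosal_TC.
have dimE : dim {ffun kset n -> FX} = (#|kset n| * #|X|)%N.
  by transitivity (#|kset n| * (#|X| * 1))%N; [by []|rewrite muln1].
rewrite dimE in rkn.
exists (#|kset n| * #|X| - (before (krank L T) n + krank L T n))%N; last first.
  exact: subnK.
rewrite (betti_salvetti F iota1 iotaM iota_inj cX_iota cX_inv rXK).
pose B := limg (linfun (@dkoszul F V L FX T n)).
pose Q := sal_coinvariants F iota1 iotaM iota_inj cX_iota cX_inv rXK.
have BE : @coboundary _ _ _ Q n = [set x | x \in B]%classic.
  apply/seteqP; split => x /=.
    by move=> [y _ <-]; rewrite -[X in X \in _]lfunE memv_img ?memvf.
  by move=> /memv_imgP[y _ ->]; rewrite lfunE; exists y.
rewrite BE subnDA; case: n rkn dimE @B BE => [|n] rkn dimE B BE.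
  have -> : @cocycle _ _ _ Q 0 = [set x | x \in fullv]%classic.
    by apply/seteqP; split => x //= _; exact: memvf.
  by rewrite [LHS]quotient_dim_vspace ?subvf// dimvf dimE subn0.
pose Z := lker (linfun (@dkoszul F V L FX T n)).
have -> : @cocycle _ _ _ Q n.+1 = [set x | x \in Z]%classic.
  by apply/seteqP; split => x /=; rewrite memv_ker lfunE => /eqP.
have BZ : (B <= Z)%VS.
  apply/subvP => _ /memv_imgP[c _ ->].
  by rewrite memv_ker !lfunE; apply/eqP; apply: dkoszulK; exact: cosal_TC.
rewrite [LHS]quotient_dim_vspace// -dimE -dimvf.
by rewrite -(limg_ker_dim (linfun (@dkoszul F V L FX T n)) fullv) capfv addnK.
Qed.

Lemma betti_defect (R : realType) n : exists b : nat,
  [/\ betti R F (BG K) n = b%:R%:E,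
      (b <= #|X| * clique_betti F L n + clique_error L n * kernel_defect T)%N &
      (#|X| * clique_betti F L n <= b + clique_error L n * kernel_defect T)%N].
Proof.
have [b bE bdim] := betti_rank R n; exists b.
have cE := clique_bettiE F L n.
have k1 := krank_le cosal_TC n; have k2 := krank_id_le cosal_TC n.
rewrite krank_id_ffun in k1; rewrite krank_id_ffun in k2.
have k0 : (before (krank L T) n <=
      #|X| * before (krank_id L (F^o : vectType F)) n +
      #|kset n.-1| * kernel_defect T)%N /\
    (#|X| * before (krank_id L (F^o : vectType F)) n <=
      before (krank L T) n + #|kset n| * kernel_defect T)%N.
  case: (n) => [|k] /=; first by rewrite muln0.
  by rewrite -krank_id_ffun; split;
    [exact: (krank_le cosal_TC) | exact: (krank_id_le cosal_TC)].
rewrite /clique_error; move: (kernel_defect T) k0 k1 k2 => kd k0 k1 k2.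
by split => //; nia.
Qed.

Lemma mvX_iter g j q : iter j (mv g) q = mv (g ^+ j)%g q.
Proof.
elim: j => [|j IH]; first by rewrite expg0 mvX1.
by rewrite iterS IH (mvXM cX_iota cX_inv rXK) expgSr.
Qed.

(** The kernel consists of the functions constant on the orbits of g_v, and by hypothesis each orbit
    has at least m points. *)
Lemma lker_cosal_T v m :
  (forall q j, (0 < j < m)%N -> mv (gen L v ^+ j)%g q <> q) ->
  (m * \dim (lker (linfun (T v))) <= #|X|)%N.
Proof.
move=> free; pose f := mv (gen L v).
have f_inj : injective f by exact: can_inj (mvXK cX_iota cX_inv rXK _).
pose root_type : finType := {q : X | froot f q == q}.
pose restr (h : FX) : {ffun root_type -> F^o} := [ffun t => h (val t)].
have restr_lin : linear restr by move=> a h h'; apply/ffunP => t; rewrite !ffunE.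
pose rs : {linear FX -> {ffun root_type -> F^o}} := mk_linear restr_lin.
have sym := fconnect_sym f_inj.
have dimk : (\dim (lker (linfun (T v))) <= #|root_type|)%N.
  (* Restriction to one root per orbit is injective on the kernel. *)
  rewrite -(@limg_dim_eq _ _ _ (linfun rs)); last first.
    apply/eqP; rewrite -subv0; apply/subvP => h /memv_capP[].
    rewrite !memv_ker !lfunE memv0 => /eqP Th /eqP rh.
    have hf q : h (f q) = h q.
      have /ffunP/(_ (f q)) := Th; rewrite cosal_TE [RHS]ffunE.
      rewrite (mvXK cX_iota cX_inv rXK) => /eqP.
      by rewrite subr_eq0 => /eqP ->.
    have hconn x y : fconnect f x y -> h x = h y.
      move=> /connectP[p px ->]; elim: p x px => //= z p IH x /andP[/eqP <- pz].
      by rewrite -(IH _ pz) hf.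
    have hroot q : h (froot f q) = h q by apply: hconn; rewrite sym connect_root.
    apply/eqP/ffunP => q; rewrite -hroot [RHS]ffunE.
    have rq : froot f (froot f q) == froot f q.
      by rewrite (root_root sym).
    by have /ffunP/(_ (exist _ (froot f q) rq)) := rh; rewrite !ffunE.
  apply: leq_trans (dimvS (subvf _)) _; rewrite dimvf.
  by apply: eq_leq; exact: muln1.
apply: (@leq_trans (m * #|root_type|)); first by rewrite leq_mul2l dimk orbT.
rewrite card_sig mulnC -sum_nat_const.
rewrite (eq_bigl (fun q => froot f q == q))//.
rewrite -sum1_card.
rewrite [leqRHS](partition_big (froot f) [pred q | froot f q == q])/=; last first.
  by move=> q _; rewrite (root_root sym).
apply: leq_sum => r /eqP rr; rewrite sum1_card.
have -> : #|[pred q | froot f q == r]| = fingraph.order f r.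
  apply: eq_card => q; rewrite !inE -[in LHS]rr (root_connect sym) sym.
  by [].
(* An orbit with fewer than m points would return to its root after that many steps, against
   [free]. *)
rewrite leqNgt; apply/negP => om.
have o0 : (0 < fingraph.order f r)%N by exact: order_gt0.
apply: (free r (fingraph.order f r)); first by rewrite o0.
by rewrite -mvX_iter iter_order.
Qed.

End SalvettiBounds.

(** * Residual chains *)

Section Cosets.
Variables (G : groupType) (H : groupClosed G).

(** The index counts left cosets whereas the homology uses right ones. Inversion matches them:
    [rc x] is the left coset of x^-1, and it determines the right coset of x. *)
Lemma finite_index_cosets : finite_index H ->
  exists (X : finType) (c : G -> X) (r : X -> G),
  [/\ #|X| = subgroup_index H, cancel r c &
      forall x y, c x = c y <-> (x / y)%g \in H].
Proof.
move=> finH; pose X : finType := fset_set (left_cosets H).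
pose rc (x : G) : set G := [set y | (x * y)%g \in H]%classic.
have rcX x : rc x \in fset_set (left_cosets H).
  rewrite in_fset_set//; apply/mem_set; exists x^-1%g => //.
  by rewrite invgK.
have ex (q : X) : exists x, rc x = val q.
  have := valP q; rewrite in_fset_set// => /set_mem[x _ <-].
  by exists x^-1%g.
have [r rE] := choice ex.
exists X, (fun x => FSetSub (rcX x)), r; split.
- by rewrite /subgroup_index cardfE.
- by move=> q; apply: val_inj; rewrite /= rE.
- move=> x y; split=> [/(congr1 val)/= e|xy].
    have : rc y y^-1%g by rewrite /rc /= mulgV; exact: gpred1.
    by rewrite -e.
  apply: val_inj; apply/seteqP; split => z h.
    suff : (y * z)%g \in H by []. have {}h : (x * z)%g \in H := h.
    have -> : (y * z = (x / y)^-1 * (x * z))%g by rewrite invgF -mulgA mulKg.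
    by rewrite gpredM ?gpredV.
  suff : (x * z)%g \in H by []. have {}h : (y * z)%g \in H := h.
  have -> : (x * z = (x / y) * (y * z))%g by rewrite -mulgA mulKg.
  by rewrite gpredM.
Qed.

End Cosets.

Section ResidualChains.

Lemma eventually_forall (I : finType) (P : I -> nat -> Prop) :
  (forall i, exists k0, forall k, (k0 <= k)%N -> P i k) ->
  exists k0, forall k, (k0 <= k)%N -> forall i, P i k.
Proof.
move=> /choice[f fP]; exists (\max_i f i)%N => k fk i; apply: fP.
by apply: leq_trans fk; exact: leq_bigmax.
Qed.

Lemma residual_chain_notin (G : groupType) (K : nat -> groupClosed G) (x : G) :
  residual_chain K -> x <> 1%g ->
  exists k0, forall k, (k0 <= k)%N -> x \notin K k.
Proof.
move=> [sub _ _ triv] x1.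
have [k0 xk0] : exists k, x \notin K k.
  apply: contrapT => h; apply: x1; apply: triv => k.
  by apply: contrapT => /negP xk; apply: h; exists k.
exists k0 => k; elim: k => [|k IH]; first by rewrite leqn0 => /eqP <-.
rewrite leq_eqVlt => /predU1P[<-//|k0k]; apply: contra (IH k0k).
exact: sub.
Qed.

End ResidualChains.

Section Asymptotics.
Variables (R : realType) (F : fieldType) (V : finType) (L : simplicial_complex V).
Variables (K : nat -> groupType) (iota : forall k, K k -> raag L).
Variables (X : nat -> finType) (cX : forall k, raag L -> X k).
Variables (rX : forall k, X k -> raag L).
Hypothesis iota1 : forall k, iota (1%g : K k) = 1%g.
Hypothesis iotaM : forall k (a b : K k), iota (a * b)%g = (iota a * iota b)%g.
Hypothesis iota_inj : forall k, injective (@iota k).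
Hypothesis cX_iota : forall k (a : K k) g, cX k (iota a * g)%g = cX k g.
Hypothesis cX_inv :
  forall k g h, cX k g = cX k h -> exists a : K k, g = (iota a * h)%g.
Hypothesis rXK : forall k, cancel (@rX k) (@cX k).
Hypothesis free : forall m, exists k0, forall k, (k0 <= k)%N ->
  forall v (q : X k) j, (0 < j < m)%N ->
  cX k (rX q * gen L v ^+ j)%g <> q.

Lemma betti_ratio_cvg n :
  ((fun k => betti R F (BG (K k)) n * (#|X k|%:R^-1)%:E)%E @ \oo -->
   (clique_betti F L n)%:R%:E)%classic.
Proof.
have est k := betti_defect F (@iota1 k) (@iotaM k) (@iota_inj k) (@cX_iota k)
  (@cX_inv k) (@rXK k) R n.
have [b bE] := choice est.
have -> : (fun k => betti R F (BG (K k)) n * (#|X k|%:R^-1)%:E)%E =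
    (fun k => ((b k)%:R / #|X k|%:R)%:E).
  by apply/funext => k; have [-> _ _] := bE k; rewrite -EFinM.
apply: cvg_EFin; first by near=> k.
apply/cvgrPdist_le => e e0.
(* With d the kernel defect and N the number of cosets, b is within [clique_error L n] times d of N
   times the limit, and m d is at most #|V| N. So the ratio is within C / m of the limit, and any m
   beyond C / e suffices. *)
pose C : nat := (clique_error L n * #|V|)%N.
have [m mC] : exists m : nat, C%:R / e < m%:R :> R.
  exists (Num.bound (C%:R / e : R)); apply: le_lt_trans (archi_boundP _).
    exact: lexx.
  by rewrite divr_ge0 ?ler0n// ltW.
have [k0 k0P] := free m.
exists k0 => // k /= k0k.
have N0 : (0 < #|X k|)%N by apply/card_gt0P; exists (cX k 1%g).
have [_ b1 b2] := bE k.
have kd : (m * kernel_defect (cosal_T F (@cX k) (@rX k)) <= #|V| * #|X k|)%N.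
  rewrite /kernel_defect big_distrr /= -sum_nat_const; apply: leq_sum => v _.
  apply: (lker_cosal_T F (@cX_iota k) (@cX_inv k) (@rXK k)) => q j jm.
  exact: k0P.
have c1 : (m * b k <= m * (#|X k| * clique_betti F L n) + C * #|X k|)%N.
  move: (kernel_defect _) b1 b2 kd => d b1 b2 kd; rewrite /C; nia.
have c2 : (m * (#|X k| * clique_betti F L n) <= m * b k + C * #|X k|)%N.
  move: (kernel_defect _) b1 b2 kd => d b1 b2 kd; rewrite /C; nia.
have m0 : 0 < m%:R :> R.
  by apply: le_lt_trans mC; rewrite divr_ge0 ?ler0n// ltW.
have NR : 0 < #|X k|%:R :> R by rewrite ltr0n.
rewrite -(ler_pM2r NR) -{2}(gtr0_norm NR) -normrM mulrBl divfK ?gt_eqF//.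
rewrite -(ler_pM2l m0) -{1}(gtr0_norm m0) -normrM.
apply: (@le_trans _ _ (C%:R * #|X k|%:R)); last first.
  by rewrite mulrA ler_pM2r// -ler_pdivrMr//; exact: ltW.
have c1R : m%:R * (b k)%:R <=
    m%:R * (#|X k|%:R * (clique_betti F L n)%:R) + C%:R * #|X k|%:R :> R.
  by rewrite -!natrM -natrD ler_nat.
have c2R : m%:R * (#|X k|%:R * (clique_betti F L n)%:R) <=
    m%:R * (b k)%:R + C%:R * #|X k|%:R :> R.
  by rewrite -!natrM -natrD ler_nat.
by rewrite ler_norml; apply/andP; split; lra.
Unshelve. all: by end_near.
Qed.

End Asymptotics.

(** * Chains in a finite index subgroup, with Y the set G\Gamma *)

Section FiniteIndexSubgroup.
Variables (R : realType) (F : fieldType) (V : finType) (L : simplicial_complex V).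
Variables (G : groupType) (f : G -> raag L) (Y : finType).
Variables (cY : raag L -> Y) (rY : Y -> raag L).
Hypothesis f1 : f 1%g = 1%g.
Hypothesis fM : forall x y, f (x * y)%g = (f x * f y)%g.
Hypothesis f_inj : injective f.
Hypothesis rYK : cancel rY cY.
Hypothesis cYP : forall g h, cY g = cY h <-> exists x, g = (f x * h)%g.
Variable (K : nat -> groupClosed G).
Hypothesis resK : residual_chain K.

Lemma l2betti_finite_index n :
  l2betti R F K n = (#|Y| * clique_betti F L n)%N%:R%:E.
Proof.
have [_ normK finK _] := resK.
have cYf x g : cY (f x * g)%g = cY g by apply/cYP; exists x.
have dec g : exists x, g = (f x * rY (cY g))%g by apply/cYP; rewrite rYK.
(* [part g] is the component of g in G relative to the transversal [rY]; it identifies K\Gamma with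
   the product of Y and K\G. *)
have [part partE] := choice dec.
have partM x g : part (f x * g)%g = (x * part g)%g.
  apply: f_inj; apply: (@mulIg _ (rY (cY g))).
  by rewrite fM -mulgA -partE -[in LHS](cYf x g) -partE.
have part_r x q : part (f x * rY q)%g = x.
  rewrite partM -[RHS]mulg1; congr (_ * _)%g; apply: f_inj.
  have e := partE (rY q); rewrite rYK in e.
  by apply: (@mulIg _ (rY q)); rewrite -e f1 mul1g.
have [XK exK] := choice (fun k => finite_index_cosets (finK k)).
pose cK k := sval (cid (exK k)); pose rK k := sval (cid (svalP (cid (exK k)))).
have rKP k := svalP (cid (svalP (cid (exK k)))).
have cardXK k : #|XK k| = subgroup_index (K k) by have [] := rKP k.
have rKK k : cancel (rK k) (cK k) by have [] := rKP k.
have cKP k x y : cK k x = cK k y <-> (x / y)%g \in K k.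
  by have [_ _] := rKP k; apply.
pose X k : finType := (Y * XK k)%type.
pose iota k (x : subgroup_type (K k)) := f (val x).
pose cX k g : X k := (cY g, cK k (part g)).
pose rX k (q : X k) : raag L := (f (rK k q.2) * rY q.1)%g.
have iota1 k : iota k 1%g = 1%g by exact: f1.
have iotaM k x y : iota k (x * y)%g = (iota k x * iota k y)%g by exact: fM.
have iota_inj k : injective (iota k) by move=> x y /f_inj /val_inj.
have cX_iota k x g : cX k (iota k x * g)%g = cX k g.
  rewrite /cX cYf partM; congr pair; apply/cKP.
  by rewrite mulgK; exact: (valP x).
have cX_inv k g h : cX k g = cX k h -> exists x, g = (iota k x * h)%g.
  move=> [e1 /cKP e2]; pose x : subgroup_type (K k) :=
    exist (fun x => x \in K k) (part g / part h)%g e2.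
  exists x; rewrite /iota /=.
  by rewrite [g in LHS]partE e1 {3}(partE h) mulgA -fM mulgVK.
have rXK k : cancel (rX k) (cX k).
  by move=> [q p]; rewrite /cX /rX cYf rYK part_r rKK.
have fV x : f x^-1%g = (f x)^-1%g.
  by apply: (@mulgI _ (f x)); rewrite -fM !mulgV f1.
have free m : exists k0, forall k, (k0 <= k)%N ->
    forall v (q : X k) j, (0 < j < m)%N ->
    cX k (rX k q * gen L v ^+ j)%g <> q.
  (* The conjugates to be avoided. They do not depend on k and are finite in number, so one
     threshold works for all; those outside the image of f impose nothing. *)
  pose t (i : V * (Y * 'I_m)) := (gen L i.1 ^+ i.2.2 ^ (rY i.2.1)^-1)%g.
  have [i|k0 k0P] := @eventually_forall (V * (Y * 'I_m))%type
    (fun i k => (0 < i.2.2)%N -> forall x, f x = t i -> x \notin K k).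
    have [[x [xt i0]]|no] := pselect (exists x, f x = t i /\ (0 < i.2.2)%N).
      have x1 : x <> 1%g.
        move=> x1; move: xt; rewrite x1 f1 /t => /esym/eqP.
        by rewrite conjg_eq1 => /eqP; exact: gen_order.
      have [k0 k0P] := residual_chain_notin resK x1.
      exists k0 => k /k0P xk _ y; rewrite -xt => /f_inj ->.
      exact: xk.
    by exists 0%N => k _ i0 x xt; case: no; exists x.
  exists k0 => k /k0P {}k0P v [q p] j /andP[j0 jm] e.
  have [a aE] : exists a, (rX k (q, p) * gen L v ^+ j = iota k a * rX k (q, p))%g.
    by apply: cX_inv; rewrite e rXK.
  (* A fixed coset gives an element a of K k; conjugating it by the representative in G, which
     normality in G permits, leaves only the representative of q in Y. *)
  have xt : f (val a ^ rK k p)%g = t (v, (q, Ordinal jm)).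
    rewrite /t /= !conjgE !fM fV invgK; apply: (@mulgI _ (f (rK k p))).
    apply: (@mulIg _ (rY q)); rewrite mulVKg -!mulgA mulVg mulg1.
    by move: aE; rewrite /rX /iota /= -!mulgA => ->.
  have := k0P (v, (q, Ordinal jm)) j0 _ xt; rewrite normK//.
  exact: (valP a).
have cvg := @betti_ratio_cvg R F V L (fun k => subgroup_type (K k)) iota X cX rX
  iota1 iotaM iota_inj cX_iota cX_inv rXK free n.
have Y0 : (0 < #|Y|)%N by apply/card_gt0P; exists (cY 1%g).
rewrite /l2betti.
(* The index of K k in Gamma is #|Y| times its index in G, so normalising by the latter multiplies
   the limit by #|Y|. *)
have -> : (fun k => betti R F (BG (subgroup_type (K k))) n *
      ((subgroup_index (K k))%:R^-1)%:E)%E =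
    (fun k => (#|Y|%:R : R)%:E *
      (betti R F (BG (subgroup_type (K k))) n * (#|X k|%:R^-1)%:E))%E.
  apply/funext => k; rewrite muleCA; congr (_ * _)%E.
  rewrite card_prod cardXK natrM invfM -EFinM mulrA divff ?mul1r//.
  by rewrite pnatr_eq0 -lt0n.
have cvgY := cvgeZl (y := #|Y|%:R%:E) isT cvg.
rewrite is_cvg_limn_esupE; last by apply/cvg_ex; eexists; exact: cvgY.
by rewrite (cvg_lim _ cvgY)// natrM EFinM.
Qed.

End FiniteIndexSubgroup.

Theorem corollary10 (R : realType) (F : fieldType)
    (V : finType) (L : simplicial_complex V) (flagL : is_flag L)
    (H : groupClosed (raag L)) (finH : finite_index H)
    (KH : nat -> groupClosed (subgroup_type H)) (resKH : residual_chain KH)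
    (KG : nat -> groupClosed (raag L)) (resKG : residual_chain KG) (i : nat) :
  l2betti R F KH i = ((subgroup_index H)%:R%:E * l2betti R F KG i)%E.
Proof.
have [Y [c [r [YE rK cP]]]] := finite_index_cosets finH.
rewrite (@l2betti_finite_index R F V L (subgroup_type H) val Y c r
  erefl (fun _ _ => erefl) val_inj rK _ KH resKH).
(* For Gamma itself the coset space is a single point, so both sides are expressed through the same
   [clique_betti]. *)
rewrite (@l2betti_finite_index R F V L (raag L) id unit (fun=> tt) (fun=> 1%g)
  erefl (fun _ _ => erefl) (fun _ _ => id) _ _ KG resKG).
- by rewrite card_unit mul1n YE natrM EFinM.
- by case.
- by move=> g h; split=> // _; exists (g / h)%g; rewrite mulgVK.
- move=> g h; split=> [/cP gh|[x ->]].
    pose x : subgroup_type H :=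
      exist (fun x => x \in H) (g / h)%g gh.
    by exists x; rewrite /= mulgVK.
  by apply/cP; rewrite mulgK; exact: (valP x).
Qed.
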